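(* Let $X$ be a smooth, connected, paracompact Hausdorff manifold of dimension $n$. Let $\xi\in\mathfrak{X}(X)$ be a smooth vector field on $X$ which is $\mathcal{G}$-complete, with flow $\Phi$, and suppose that $\xi(x_0)\neq 0$ for some $x_0\in X$. Then there exists a neighborhood $U$ of $x_0$ in $X$ such that a generalized function $u\in\mathcal{G}(U)$ is invariant under $\Phi$ if and only if $u$ possesses a representative $(u_\varepsilon)_\varepsilon$ such that each $u_\varepsilon\in C^\infty(U)$ is invariant under $\Phi$.
   Context: Let $I=(0,1]$. For a smooth manifold $M$, $\mathcal{E}_M(M)$ denotes the set of nets $(u_\varepsilon)_{\varepsilon\in I}$ in $C^\infty(M)$ that are moderate: for every compact $K\subset M$ and every linear differential operator $P$ on $M$ with smooth coefficients there is $N\in\mathbb{N}$ with $\sup_{x\in K}|Pu_\varepsilon(x)|=O(\varepsilon^{-N})$ as $\varepsilon\to 0$. $\mathcal{N}(M)$ denotes the set of negligible nets: for all such $K,P$ and every $m\in\mathbb{N}$, $\sup_{x\in K}|Pu_\varepsilon(x)|=O(\varepsilon^{m})$. The Colombeau algebra is $\mathcal{G}(M)=\mathcal{E}_M(M)/\mathcal{N}(M)$; write $u=[(u_\varepsilon)_\varepsilon]$. If $F:M'\to M$ is smooth, $u\circ F:=[(u_\varepsilon\circ F)_\varepsilon]\in\mathcal{G}(M')$. For manifolds $M,Y$, $\mathcal{G}[M,Y]$ is the space of generalized maps: equivalence classes of nets $(F_\varepsilon)_\varepsilon$ of smooth maps $M\to Y$ that are c-bounded (for every compact $K\subset M$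 there are $\varepsilon_0>0$ and a compact $K'\subset Y$ with $F_\varepsilon(K)\subseteq K'$ for all $\varepsilon<\varepsilon_0$) and moderate ($(f\circ F_\varepsilon)_\varepsilon\in\mathcal{E}_M(M)$ for all $f\in C^\infty(Y)$), where $(F_\varepsilon)\sim(F'_\varepsilon)$ iff $(f\circ F_\varepsilon-f\circ F'_\varepsilon)_\varepsilon\in\mathcal{N}(M)$ for all $f\in C^\infty(Y)$. A smooth vector field $\xi$ on $X$ is called $\mathcal{G}$-complete if there is a unique $\Phi\in\mathcal{G}[\mathbb{R}\times X,X]$ (its generalized flow) with $\frac{d}{dt}\Phi(t,x)=\xi(\Phi(t,x))$ (i.e., $\frac{d}{dt}(f\circ\Phi)=(\xi f)\circ\Phi$ in $\mathcal{G}(\mathbb{R}\times X)$ for all $f\in C^\infty(X)$), $\Phi(0,\cdot)=\mathrm{id}_X$ in $\mathcal{G}[X,X]$, and $\Phi(t+s,\cdot)=\Phi(t,\Phi(s,\cdot))$ in $\mathcal{G}[\mathbb{R}^2\times X,X]$. For such a smooth $\xi$ the generalized flow coincides with the classical smooth flow $\Phi:\mathbb{R}\times X\to X$. Invariance: $u\in\mathcal{G}(X)$ is invariant under $\Phi$ if $u\circ\Phi=u\circ\pi_2$ in $\mathcal{G}(\mathbb{R}\times X)$, where $\pi_2:\mathbb{R}\times X\to X$ is the projection. For an open set $U\subseteq X$, invariance is understood with respect to the local flow induced on $U$: with $\mathcal{V}_U=\{(\eta,x)\in\mathbb{R}\times U:\Phi(s,x)\in U\text{ for all } s \text{ between } 0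 \text{ and } \eta\}$ (open), $u\in\mathcal{G}(U)$ is invariant under $\Phi$ if $u\circ\Phi=u\circ\pi_2$ in $\mathcal{G}(\mathcal{V}_U)$, and a function $g\in C^\infty(U)$ is invariant under $\Phi$ if $g\circ\Phi=g\circ\pi_2$ on $\mathcal{V}_U$. *)

(* Defs.v *)
From mathcomp Require Import all_boot all_order all_algebra.
From mathcomp Require Import all_classical all_reals all_analysis.

Set Implicit Arguments.
Unset Strict Implicit.
Unset Printing Implicit Defensive.

Import Order.TTheory GRing.Theory Num.Theory.
Import numFieldNormedType.Exports.

Local Open Scope classical_set_scope.
Local Open Scope ring_scope.

Definition dirD (R : realType) (E F : normedModType R) (vs : seq E)
    (f : E -> F) : E -> F :=
  foldr (fun v g => 'D_v g) f vs.

(* In finite dimension, this is the usual class C^oo: all iterated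
   directional (equivalently, partial) derivatives exist and are continuous.
   W is meant to be open; the values of f outside W are irrelevant. *)
Definition smooth_in (R : realType) (E F : normedModType R) (W : set E)
    (f : E -> F) : Prop :=
  forall (vs : seq E) (x : E), W x ->
    {for x, continuous (dirD vs f)} /\
    forall v : E, derivable (dirD vs f) x v.

(* Manifolds are topological spaces X with an atlas of charts into a normed
   space E, which is 'rV[R]_n for an n-dimensional manifold. Using a general E
   makes the model space of R x X the product R * E. *)

Record chart (R : realType) (E : normedModType R) (X : topologicalType) :=
  Chart { cdom : set X ; cmap : X -> E ; cinv : E -> X }.

(* cmap restricts to a homeomorphism from the open set cdom onto an open subset
   of E, with inverse cinv. *)
Definition is_chart (R : realType) (E : normedModType R) (X : topologicalType)
    (c : chart E X) : Prop :=
  [/\ open (cdom c),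
      open (cmap c @` cdom c),
      forall x, cdom c x -> cinv c (cmap c x) = x,
      forall x, cdom c x -> {for x, continuous (cmap c)} &
      forall y, (cmap c @` cdom c) y -> {for y, continuous (cinv c)}].

Definition smooth_atlas (R : realType) (E : normedModType R)
    (X : topologicalType) (A : set (chart E X)) : Prop :=
  [/\ forall c, A c -> is_chart c,
      forall x, exists2 c, A c & cdom c x &
      forall c d, A c -> A d ->
        smooth_in (cmap c @` (cdom c `&` cdom d)) (cmap d \o cinv c)].

Definition paracompact (X : topologicalType) : Prop :=
  forall C : set (set X),
    (forall U, C U -> open U) -> \bigcup_(U in C) U = setT ->
  exists D : set (set X),
    [/\ forall V, D V -> open V,
        \bigcup_(V in D) V = setT,
        forall V, D V -> exists2 U, C U & V `<=` U &
        forall x : X, exists2 N, nbhs x N &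
          finite_set [set V | D V /\ V `&` N !=set0]].

(* A chart around x; the default value is never used when A is an atlas. *)
Definition chart_at (R : realType) (E : normedModType R) (X : topologicalType)
    (A : set (chart E X)) (x : X) : chart E X :=
  xget (Chart set0 (fun=> 0) (fun=> x) : {classic (chart E X)})
       [set c : chart E X | A c /\ cdom c x].

Definition prod_chart (R : realType) (E : normedModType R)
    (X : topologicalType) (c : chart E X) :
    chart (R * E)%type (R * X)%type :=
  Chart [set p : R * X | cdom c p.2]
        (fun p => (p.1, cmap c p.2)) (fun q => (q.1, cinv c q.2)).

(* The atlas of the product manifold R x X. *)
Definition prod_atlas (R : realType) (E : normedModType R)
    (X : topologicalType) (A : set (chart E X)) :
    set (chart (R * E)%type (R * X)%type) :=
  [set prod_chart c | c in A].

(* An open submanifold W of X is handled as a subset: functions on W are total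
   functions whose values outside W are irrelevant. *)
Definition smooth_on (R : realType) (E F : normedModType R)
    (X : topologicalType) (A : set (chart E X)) (W : set X) (f : X -> F) :
    Prop :=
  forall c, A c -> smooth_in (cmap c @` (W `&` cdom c)) (f \o cinv c).

Definition smooth_map (R : realType) (E E' : normedModType R)
    (M Y : topologicalType) (A : set (chart E M)) (B : set (chart E' Y))
    (F : M -> Y) : Prop :=
  continuous F /\
  forall c d, A c -> B d ->
    smooth_in (cmap c @` (cdom c `&` F @^-1` cdom d))
              (cmap d \o F \o cinv c).

(* Vector fields are given by their components: xi c x is the component vector
   of xi(x) in the chart c, meaningful for x in cdom c; components in different
   charts are related by the derivative of the change of coordinates. *)
Definition vector_field (R : realType) (E : normedModType R)
    (X : topologicalType) (A : set (chart E X)) (xi : chart E X -> X -> E) :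
    Prop :=
  (forall c, A c -> smooth_in (cmap c @` cdom c) (xi c \o cinv c)) /\
  (forall c d x, A c -> A d -> cdom c x -> cdom d x ->
     xi d x = 'D_(xi c x) (cmap d \o cinv c) (cmap c x)).

Definition lie (R : realType) (E : normedModType R) (X : topologicalType)
    (A : set (chart E X)) (xi : chart E X -> X -> E) (f : X -> R) : X -> R :=
  fun x => let c := chart_at A x in
    'D_(xi c x) (f \o cinv c : E -> R^o) (cmap c x).

Definition ddt (R : realType) (X : topologicalType) (f : R * X -> R) :
    R * X -> R :=
  fun p => derive1 (fun s : R => f (s, p.2) : R^o) p.1.

(* Linear differential operators on W with smooth coefficients: in every chart
   c, P is a finite sum of terms a_i D_{v_i1} ... D_{v_ik}, with a_i smooth. *)
Definition diff_op (R : realType) (E : normedModType R) (X : topologicalType)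
    (A : set (chart E X)) (W : set X) (P : (X -> R) -> (X -> R)) : Prop :=
  forall c, A c ->
  exists (k : nat) (a : 'I_k -> X -> R) (vs : 'I_k -> seq E),
    (forall i,
       smooth_in (cmap c @` (W `&` cdom c)) (a i \o cinv c : E -> R^o)) /\
    forall f : X -> R, smooth_on A W (f : X -> R^o) ->
    forall x, W x -> cdom c x ->
      P f x =
      \sum_(i < k) a i x * dirD (vs i) (f \o cinv c : E -> R^o) (cmap c x).

(* Nets indexed by ]0, 1] are represented by functions on R of which only the
   values at e in ]0, 1] matter. *)

Definition smooth_net (R : realType) (E : normedModType R)
    (X : topologicalType) (A : set (chart E X)) (W : set X)
    (u : R -> X -> R) : Prop :=
  forall e, 0 < e <= 1 -> smooth_on A W (u e : X -> R^o).

(* sup_K |P u_e| = O(e^-N) as e -> 0+. *)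
Definition moderate (R : realType) (E : normedModType R)
    (X : topologicalType) (A : set (chart E X)) (W : set X)
    (u : R -> X -> R) : Prop :=
  smooth_net A W u /\
  forall (K : set X) (P : (X -> R) -> (X -> R)),
    compact K -> K `<=` W -> diff_op A W P ->
  exists (N : nat) (C : R), \forall e \near 0^'+,
    forall x, K x -> `|P (u e) x| <= C * e ^- N.

Definition negligible (R : realType) (E : normedModType R)
    (X : topologicalType) (A : set (chart E X)) (W : set X)
    (u : R -> X -> R) : Prop :=
  smooth_net A W u /\
  forall (K : set X) (P : (X -> R) -> (X -> R)) (m : nat),
    compact K -> K `<=` W -> diff_op A W P ->
  exists C : R, \forall e \near 0^'+,
    forall x, K x -> `|P (u e) x| <= C * e ^+ m.

(* The class of u modulo negligible nets, as the set of its representatives. *)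
Definition gclass (R : realType) (E : normedModType R) (X : topologicalType)
    (A : set (chart E X)) (W : set X) (u : R -> X -> R) :
    set (R -> X -> R) :=
  [set v | moderate A W v /\ negligible A W (fun e x => u e x - v e x)].

Definition colombeau (R : realType) (E : normedModType R)
    (X : topologicalType) (A : set (chart E X)) (W : set X) :
    set (set (R -> X -> R)) :=
  [set gclass A W u | u in moderate A W].

(* The class of the nets op v, where v ranges over the representatives of a
   class U: the operation induced on classes by op, whenever op is compatible
   with the equivalence relations. *)
Definition glift (R : realType) (E : normedModType R) (X : topologicalType)
    (A : set (chart E X)) (W : set X) (T : Type) (op : T -> R -> X -> R)
    (U : set T) : set (R -> X -> R) :=
  \bigcup_(v in U) gclass A W (op v).

Definition c_bounded (R : realType) (M Y : topologicalType)
    (F : R -> M -> Y) : Prop :=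
  forall K : set M, compact K ->
  exists (e0 : R) (K' : set Y), [/\ 0 < e0, compact K' &
    forall e, 0 < e <= 1 -> e < e0 -> F e @` K `<=` K'].

Definition gmap_net (R : realType) (E E' : normedModType R)
    (M Y : topologicalType) (A : set (chart E M)) (B : set (chart E' Y))
    (F : R -> M -> Y) : Prop :=
  [/\ forall e, 0 < e <= 1 -> smooth_map A B (F e),
      c_bounded F &
      forall f : Y -> R, smooth_on B setT (f : Y -> R^o) ->
        moderate A setT (fun e => f \o F e)].

Definition gmap_class (R : realType) (E E' : normedModType R)
    (M Y : topologicalType) (A : set (chart E M)) (B : set (chart E' Y))
    (F : R -> M -> Y) : set (R -> M -> Y) :=
  [set G | gmap_net A B G /\
     forall f : Y -> R, smooth_on B setT (f : Y -> R^o) ->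
       negligible A setT (fun e x => f (F e x) - f (G e x))].

(* The space G[M, Y] of generalized maps. *)
Definition gmap (R : realType) (E E' : normedModType R)
    (M Y : topologicalType) (A : set (chart E M)) (B : set (chart E' Y)) :
    set (set (R -> M -> Y)) :=
  [set gmap_class A B F | F in gmap_net A B].

Definition gmap_lift (R : realType) (E E' : normedModType R)
    (M Y : topologicalType) (A : set (chart E M)) (B : set (chart E' Y))
    (T : Type) (op : T -> R -> M -> Y) (U : set T) : set (R -> M -> Y) :=
  \bigcup_(F in U) gmap_class A B (op F).

Definition generalized_flow (R : realType) (E : normedModType R)
    (X : topologicalType) (A : set (chart E X)) (xi : chart E X -> X -> E)
    (Psi : set (R -> R * X -> X)) : Prop :=
  let RA := prod_atlas A in
  [/\ gmap RA A Psi,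
      forall f : X -> R, smooth_on A setT (f : X -> R^o) ->
        glift RA setT (fun u e => ddt (u e))
          (glift RA setT (fun F e => f \o F e) Psi) =
        glift RA setT (fun F e => lie A xi f \o F e) Psi,
      gmap_lift A A (fun F e x => F e (0, x)) Psi =
        gmap_class A A (fun _ x => x) &
      gmap_lift (prod_atlas RA) A
        (fun F e (q : R * (R * X)) => F e (q.1 + q.2.1, q.2.2)) Psi =
      gmap_lift (prod_atlas RA) A
        (fun F e (q : R * (R * X)) => F e (q.1, F e (q.2.1, q.2.2))) Psi].

Definition G_complete (R : realType) (E : normedModType R)
    (X : topologicalType) (A : set (chart E X)) (xi : chart E X -> X -> E) :
    Prop :=
  exists! Psi, generalized_flow A xi Psi.

(* The differential equation is written in the components of charts. *)
Definition classical_flow (R : realType) (E : normedModType R)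
    (X : topologicalType) (A : set (chart E X)) (xi : chart E X -> X -> E)
    (Phi : R * X -> X) : Prop :=
  [/\ smooth_map (prod_atlas A) A Phi,
      forall t x c, A c -> cdom c (Phi (t, x)) ->
        derive1 (fun s : R => cmap c (Phi (s, x))) t = xi c (Phi (t, x)),
      forall x, Phi (0, x) = x &
      forall t s x, Phi (t + s, x) = Phi (t, Phi (s, x))].

(* The smooth map Phi is the flow of xi: it is the classical flow, and the class
   of the constant net Phi is the generalized flow. *)
Definition is_flow (R : realType) (E : normedModType R)
    (X : topologicalType) (A : set (chart E X)) (xi : chart E X -> X -> E)
    (Phi : R * X -> X) : Prop :=
  classical_flow A xi Phi /\
  generalized_flow A xi (gmap_class (prod_atlas A) A (fun _ => Phi)).

Definition flow_dom (R : realType) (X : topologicalType) (Phi : R * X -> X)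
    (U : set X) : set (R * X) :=
  [set p | U p.2 /\
     forall s, Num.min 0 p.1 <= s <= Num.max 0 p.1 -> U (Phi (s, p.2))].

Definition invariant_fun (R : realType) (X : topologicalType)
    (Phi : R * X -> X) (U : set X) (g : X -> R) : Prop :=
  forall p, flow_dom Phi U p -> g (Phi p) = g p.2.

Definition invariant_gen (R : realType) (E : normedModType R)
    (X : topologicalType) (A : set (chart E X)) (Phi : R * X -> X)
    (U : set X) (u : set (R -> X -> R)) : Prop :=
  glift (prod_atlas A) (flow_dom Phi U) (fun v e p => v e (Phi p)) u =
  glift (prod_atlas A) (flow_dom Phi U) (fun v e p => v e p.2) u.

(* Main.v *)
Require Import Defs.
From mathcomp Require Import all_boot all_order all_algebra.
From mathcomp Require Import all_classical all_reals all_analysis.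
From mathcomp Require Import lra.
Import Order.TTheory GRing.Theory Num.Theory.
Import numFieldNormedType.Exports.

(** Near a point where the vector field does not vanish, the flow has a smooth
first-hitting-time function, and this turns invariance up to negligible nets
into exact invariance.

Let c be the chart at x0 and j an index with xi_j(x0) <> 0.  The level set
S = {height = 0}, where height is the j-th coordinate centred at x0 and scaled
by xi_j(x0), is crossed in the increasing direction by every trajectory near
x0.  Let U be the union of the pieces of trajectory that start on S near x0 and
last less than delta, forwards or backwards in time.  Every x in U meets this
part of S at exactly one time theta x with |theta x| < delta, and the whole
piece of trajectory from x to S stays in U.
Then theta (Phi (s, x)) = theta x - s as long as the trajectory stays in U, and
the domain of the local flow is {(s, x) | x in U, |theta x - s| < delta}
([flow_dom_slice_box]); in particular it is open and contains all points
(theta x, x).  The map x |-> Phi (theta x, x) is constant along trajectories in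
U, and so is every function composed with it.

Given a representative u0 of an invariant class, the net
x |-> u0 (Phi (theta x, x)) is therefore invariant on the nose.  It represents
the same class because it is the pullback of u0 o Phi under the smooth section
x |-> (theta x, x), invariance says that u0 o Phi and v o pi_2 differ by a
negligible net for some other representative v, and the pullback of v o pi_2 is
v.  The converse only needs that pullbacks of negligible nets by Phi and by
pi_2 are negligible.

Three facts carry the analysis.
- A set of functions that are continuous and whose directional derivatives stay
  in the set consists of smooth functions ([smooth_in_stable],
  [smooth_in_algebra]).  Products, inverses, composites and the implicitly
  defined theta are all obtained in this way.
- The chain rule, iterated: D^vs (f o phi) is a combination of the functions
  (D^ws f) o phi whose smooth coefficients do not depend on f ([dirD_comp]).
- U lies in the domain of the single chart c.  By the iterated chain rule, the
  operators f |-> D^vs (f o c^-1) o c are then global differential operators on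
  U, so that moderateness and negligibility are conditions on coordinate
  derivatives ([net_ofP]).  The same holds on the flow domain, with the chart
  id x c.  The stability of both notions under pullback along smooth maps
  follows ([net_of_pullback]). *)

Local Open Scope classical_set_scope.
Local Open Scope ring_scope.

Set Implicit Arguments.
Unset Strict Implicit.

(** * Smooth functions: stability under algebraic operations *)

Lemma smooth_inS (R : realType) (E F : normedModType R) (W W' : set E)
    (f : E -> F) : W `<=` W' -> smooth_in W' f -> smooth_in W f.
Proof. by move=> sW sf vs x /sW; exact: sf. Qed.

Lemma smooth_in_continuous (R : realType) (E F : normedModType R) (W : set E)
    (f : E -> F) x : smooth_in W f -> W x -> {for x, continuous f}.
Proof. by move=> sf /(sf [::]) []. Qed.

Lemma smooth_in_derivable (R : realType) (E F : normedModType R) (W : set E)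
    (f : E -> F) v x : smooth_in W f -> W x -> derivable f x v.
Proof. by move=> sf /(sf [::]) []. Qed.

Lemma dirD_cat (R : realType) (E F : normedModType R) vs ws (f : E -> F) :
  dirD (vs ++ ws) f = dirD vs (dirD ws f).
Proof. exact: foldr_cat. Qed.

Lemma smooth_in_dirD (R : realType) (E F : normedModType R) (W : set E)
    (f : E -> F) vs : smooth_in W f -> smooth_in W (dirD vs f).
Proof. by move=> sf ws x Wx; rewrite -dirD_cat; exact: sf. Qed.

Lemma smooth_in_derive (R : realType) (E F : normedModType R) (W : set E)
    (f : E -> F) v : smooth_in W f -> smooth_in W ('D_v f).
Proof. exact: (@smooth_in_dirD _ _ _ _ _ [:: v]). Qed.

Lemma nbhs_eq_on (E : topologicalType) (F : Type) (W : set E)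
    (f g : E -> F) x :
  open W -> W x -> {in W, f =1 g} -> \forall y \near x, f y = g y.
Proof.
move=> oW Wx fg; have := open_nbhs_nbhs (conj oW Wx).
by apply: filterS => y Wy; apply: fg; rewrite inE.
Qed.

Lemma continuous_near_eq (S T : topologicalType) (f g : S -> T) x :
  (\forall y \near x, f y = g y) -> {for x, continuous g} ->
  {for x, continuous f}.
Proof.
move=> fg cg; rewrite /prop_for /continuous_at (nbhs_singleton fg).
apply: cvg_trans cg; apply: near_eq_cvg.
by apply: filterS fg => y ->.
Qed.

(** The bootstrap behind every smoothness proof below: by induction on vs,
    each dirD vs f agrees on W with a member of P. *)
Lemma smooth_in_stable (R : realType) (E F : normedModType R) (W : set E)
    (P : set (E -> F)) : open W ->
  (forall f x, P f -> W x -> {for x, continuous f}) ->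
  (forall f v, P f ->
     exists2 g, P g & forall x, W x -> is_derive x v f (g x)) ->
  forall f, P f -> smooth_in W f.
Proof.
move=> oW cP dP f Pf.
suff H vs : exists2 g, P g & {in W, dirD vs f =1 g}.
  move=> vs x Wx; have [g Pg fg] := H vs.
  have fgx := nbhs_eq_on oW Wx fg.
  split.
    exact: continuous_near_eq fgx (cP g x Pg Wx).
  move=> v; have [h _ /(_ _ Wx) dg] := dP g v Pg.
  apply: (near_eq_derivable _ (@ex_derive _ _ _ _ _ _ _ dg)).
  by apply: filterS fgx => y ->.
elim: vs => [|v vs [g Pg fg]]; first by exists f.
have [h Ph gh] := dP g v Pg; exists h => // x /[!inE] Wx /=.
rewrite (near_eq_derive _ (nbhs_eq_on oW Wx fg)).
exact: (@derive_val _ _ _ _ _ _ _ (gh x Wx)).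
Qed.

Lemma smooth_in_eq (R : realType) (E F : normedModType R) (W : set E)
    (f g : E -> F) :
  open W -> {in W, f =1 g} -> smooth_in W f -> smooth_in W g.
Proof.
move=> oW fg sf.
apply: (smooth_in_stable oW (P := [set h | exists2 k, smooth_in W k &
   {in W, k =1 h}])); last by exists f.
  move=> h x [k sk kh] Wx.
  apply: continuous_near_eq (smooth_in_continuous sk Wx).
  by have := nbhs_eq_on oW Wx kh; apply: filterS => y ->.
move=> h v [k sk kh]; exists ('D_v k).
  by exists ('D_v k) => //; apply: smooth_in_derive.
move=> x Wx; apply: (near_eq_is_derive (nbhs_eq_on oW Wx kh)).
by apply: derivableP; exact: (smooth_in_derivable sk Wx).
Qed.

Lemma dirD_eq (R : realType) (E F : normedModType R) (W : set E)
    (f g : E -> F) vs :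
  open W -> {in W, f =1 g} -> {in W, dirD vs f =1 dirD vs g}.
Proof.
move=> oW fg; elim: vs => [|v vs IH] //= x /[!inE] Wx.
exact: near_eq_derive (nbhs_eq_on oW Wx IH).
Qed.

(** Derivatives of products and composites are again polynomial expressions
    in simpler functions.  Closing a set of generators under sums and products
    thus yields sets to which the bootstrap applies. *)
Inductive algebra_gen (R : realType) (E : Type) (G : set (E -> R)) :
    (E -> R) -> Prop :=
  | alg_gen f : G f -> algebra_gen G f
  | alg_cst c : algebra_gen G (fun=> c)
  | alg_add f g : algebra_gen G f -> algebra_gen G g ->
      algebra_gen G (fun x => f x + g x)
  | alg_mul f g : algebra_gen G f -> algebra_gen G g ->
      algebra_gen G (fun x => f x * g x).

Lemma alg_sum (R : realType) (E : Type) (G : set (E -> R)) (I : finType)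
    (f : I -> E -> R) : (forall i, algebra_gen G (f i)) ->
  algebra_gen G (fun x => \sum_i f i x).
Proof.
move=> Gf; elim: (index_enum I) => [|i r IH].
  rewrite (_ : (fun _ => _) = (fun=> 0)); first exact: alg_cst.
  by apply/funext => x; rewrite big_nil.
rewrite (_ : (fun _ => _) = (fun x => f i x + \sum_(i <- r) f i x)).
  exact: alg_add.
by apply/funext => x; rewrite big_cons.
Qed.

(** The sum and product rules reduce the hypotheses of the bootstrap to the
    generators. *)
Lemma smooth_in_algebra (R : realType) (E : normedModType R) (W : set E)
    (G : set (E -> R)) : open W ->
  (forall f x, G f -> W x -> {for x, continuous f}) ->
  (forall f v, G f -> exists2 g, algebra_gen G g &
     forall x, W x -> is_derive x v (f : E -> R^o) (g x)) ->
  forall f, algebra_gen G f -> smooth_in W (f : E -> R^o).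
Proof.
move=> oW cG dG; apply: (smooth_in_stable oW).
  move=> f x; elim=> {f}; first by move=> f Gf Wx; exact: cG.
  - by move=> c _; exact: cst_continuous.
  - by move=> f g _ cf _ cg Wx; apply: cvgD; [exact: cf|exact: cg].
  - by move=> f g _ cf _ cg Wx; apply: cvgM; [exact: cf|exact: cg].
move=> f v; elim=> {f}; first by move=> f /(dG f v).
- move=> c; exists (fun=> 0); first exact: alg_cst.
  by move=> x _; exact: is_derive_cst.
- move=> f g _ [f' Af' df] _ [g' Ag' dg]; exists (fun x => f' x + g' x).
    exact: alg_add.
  by move=> x Wx; apply: is_deriveD; [exact: df|exact: dg].
- move=> f g Af [f' Af' df] Ag [g' Ag' dg].
  exists (fun x => f x * g' x + g x * f' x).
    by apply: alg_add; apply: alg_mul.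
  by move=> x Wx; apply: is_deriveM; [exact: df|exact: dg].
Qed.

Lemma smooth_in_gen (R : realType) (E : normedModType R) (W : set E)
    (f : E -> R) : open W ->
  algebra_gen [set g | smooth_in W (g : E -> R^o)] f -> smooth_in W (f : E -> R^o).
Proof.
move=> oW; apply: (smooth_in_algebra oW).
  by move=> g x; exact: smooth_in_continuous.
move=> g v sg; exists ('D_v (g : E -> R^o)).
  by apply: alg_gen; exact: smooth_in_derive.
by move=> x Wx; apply: derivableP; exact: (smooth_in_derivable sg Wx).
Qed.

Lemma smooth_inD (R : realType) (E : normedModType R) (W : set E)
    (f g : E -> R^o) : open W -> smooth_in W f -> smooth_in W g ->
  smooth_in W (fun x => f x + g x).
Proof.
move=> oW sf sg; apply: (smooth_in_gen oW).
by apply: (alg_add (alg_gen _) (alg_gen _)); [exact: sf|exact: sg].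
Qed.

Lemma smooth_inM (R : realType) (E : normedModType R) (W : set E)
    (f g : E -> R^o) : open W -> smooth_in W f -> smooth_in W g ->
  smooth_in W (fun x => f x * g x : R^o).
Proof.
move=> oW sf sg; apply: (smooth_in_gen oW).
by apply: (alg_mul (alg_gen _) (alg_gen _)); [exact: sf|exact: sg].
Qed.

Lemma smooth_in_cst (R : realType) (E : normedModType R) (W : set E) (c : R) :
  open W -> smooth_in W (fun=> c : R^o).
Proof. by move=> oW; apply: (smooth_in_gen oW); exact: alg_cst. Qed.

(** 1/f is adjoined as one generator, with D_v (1/f) = - (1/f)^2 D_v f. *)
Lemma smooth_inV (R : realType) (E : normedModType R) (W : set E)
    (f : E -> R^o) : open W -> smooth_in W f -> (forall x, W x -> f x != 0) ->
  smooth_in W (fun x => (f x)^-1 : R^o).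
Proof.
move=> oW sf f0.
pose G := [set g | smooth_in W (g : E -> R^o)] `|` [set (fun x => (f x)^-1)].
apply: (smooth_in_algebra oW (G := G)); last by apply: alg_gen; right.
  move=> g x [sg|->] Wx; first exact: smooth_in_continuous sg Wx.
  by apply: cvgV; [exact: f0|exact: smooth_in_continuous sf Wx].
move=> g v [sg|->].
  exists ('D_v (g : E -> R^o)).
    by apply: alg_gen; left; exact: smooth_in_derive.
  by move=> x Wx; apply: derivableP; exact: (smooth_in_derivable sg Wx).
exists (fun x => -1 * ((f x)^-1 * (f x)^-1) * 'D_v f x).
  apply: alg_mul; last by apply: alg_gen; left; exact: smooth_in_derive.
  apply: alg_mul; first exact: alg_cst.
  by apply: alg_mul; apply: alg_gen; right.
move=> x Wx; have fx := f0 x Wx; have df := smooth_in_derivable (v:=v) sf Wx.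
apply: DeriveDef; first exact: derivableV.
by rewrite deriveV// mulN1r expr2 invfM.
Qed.

Lemma is_derive_linear (R : realType) (E : normedModType R) (l : E -> R) x v :
  (forall a x y, l (a *: x + y) = a * l x + l y) ->
  is_derive x v (l : E -> R^o) (l v).
Proof.
move=> linl.
have H : (h^-1 *: ((l \o shift x) (h *: v) - l x) : R^o) @[h --> 0^'] --> (l v : R^o).
  apply: cvg_near_cst; near=> h.
  rewrite /= linl addrK /GRing.scale/= mulrA mulVf ?mul1r//.
  by near: h; exact: nbhs_dnbhs_neq.
by apply: DeriveDef; [apply/cvg_ex; exists (l v)|exact: cvg_lim].
Unshelve. all: by end_near. Qed.

Lemma smooth_in_linear (R : realType) (E : normedModType R) (W : set E)
    (l : E -> R) : open W -> continuous l ->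
  (forall a x y, l (a *: x + y) = a * l x + l y) ->
  smooth_in W (l : E -> R^o).
Proof.
move=> oW cl linl.
apply: (smooth_in_algebra oW (G := [set l])); last exact: alg_gen.
  by move=> _ x -> _; exact: cl.
move=> _ v ->; exists (fun=> l v); first exact: alg_cst.
by move=> x _; exact: is_derive_linear.
Qed.

(** * The chain rule and its iterates *)

Lemma cvg_near_eq (T : Type) (U : topologicalType) (F : set_system T)
    {FF : Filter F} (f g : T -> U) (l : U) :
  (\forall t \near F, f t = g t) -> g @ F --> l -> f @ F --> l.
Proof.
move=> fg; apply: cvg_trans; apply: near_eq_cvg.
by apply: filterS fg => t ->.
Qed.

Lemma mvt_direction (R : realType) (E : normedModType R) (g : E -> R^o)
    (z e : E) (c : R) :
  (forall s, `|s| <= `|c| -> derivable g (z + s *: e) e) ->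
  exists2 s, `|s| <= `|c| & g (z + c *: e) - g z = 'D_e g (z + s *: e) * c.
Proof.
move=> dg.
pose f (s : R) : R := g (z + s *: e).
have df (s : R) : `|s| <= `|c| -> is_derive s 1 f ('D_e g (z + s *: e)).
  move=> sc; have dgs := dg s sc.
  have E1 : (fun h : R => h^-1 *: ((f \o shift s) (h *: 1) - f s)) =
     (fun h : R => h^-1 *: ((g \o shift (z + s *: e)) (h *: e) - g (z + s *: e))).
    apply/funext => h; rewrite /f /=; congr (_ *: (g _ - _)).
    by rewrite scalerDl addrCA /GRing.scale/= mulr1.
  by apply: DeriveDef; rewrite /derivable /derive E1.
have [c0|c0] := leP 0 c.
  have [||s s0c Hs] := @MVT_segment R f (fun s => 'D_e g (z + s *: e)) 0 c c0.
  - move=> s; rewrite in_itv/= => /andP[s0 sc]; apply: df.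
    by rewrite !ger0_norm// ltW.
  - apply: derivable_within_continuous => s; rewrite in_itv/= => /andP[s0 sc].
    by have [] : is_derive s 1 f _ := df s _; rewrite ?ger0_norm.
  exists s; last by move: Hs; rewrite subr0 /f scale0r addr0.
  by move: s0c; rewrite in_itv/= => /andP[s0 sc]; rewrite !ger0_norm.
have [||s s0c Hs] := @MVT_segment R f (fun s => 'D_e g (z + s *: e)) c 0 (ltW c0).
- move=> s; rewrite in_itv/= => /andP[s0 sc]; apply: df.
  by rewrite !ltr0_norm// lerN2 ltW.
- apply: derivable_within_continuous => s; rewrite in_itv/= => /andP[s0 sc].
  by have [] : is_derive s 1 f _ := df s _; rewrite ?(ltr0_norm c0) ?ler0_norm// lerN2.
exists s; last first.
  by move: Hs; rewrite sub0r /f scale0r addr0 mulrN => /(congr1 -%R); rewrite opprB opprK.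
by move: s0c; rewrite in_itv/= => /andP[s0 sc]; rewrite (ltr0_norm c0) ler0_norm// lerN2.
Qed.

(** A mean value theorem with moving base point q and step c, which may vanish.
    Writing the increment as m c, with m convergent, serves both the chain rule
    (divide by s and use the derivative of c) and the implicit function theorem
    (solve for c). *)
Lemma increment (R : realType) (E : normedModType R) (g : E -> R^o) (y e : E)
    (T : Type) (F : set_system T) {FF : Filter F} (q : T -> E) (c : T -> R) :
  (\forall z \near y, derivable g z e) -> {for y, continuous ('D_e g)} ->
  q @ F --> y -> c @ F --> (0 : R) ->
  exists2 m : T -> R, m @ F --> ('D_e g y : R) &
    \forall t \near F, g (q t + c t *: e) - g (q t) = m t * c t.
Proof.
move=> dg cDg qy c0.
have near_seg (P : set E) : (\forall z \near y, P z) ->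
    \forall t \near F, forall s, `|s| <= `|c t| -> P (q t + s *: e).
  move=> /nbhs_ballP[r /= r0 rP].
  have r2 : 0 < r / 2 by rewrite divr_gt0.
  have e1 : 0 < `|e| + 1 by rewrite ltr_wpDl.
  move/cvgrPdist_lt : (qy) => /(_ _ r2) qr.
  have /cvgrPdist_lt : c @ F --> (0 : R) by [].
  move=> /(_ (r / 2 / (`|e| + 1))); rewrite divr_gt0// => /(_ isT).
  apply: filterS2 qr => t qr; rewrite sub0r normrN => cr s sc; apply: rP.
  rewrite -ball_normE /= opprD addrA (le_lt_trans (ler_normB _ _))//.
  rewrite [ltRHS](splitr r) ltr_leD// normrZ.
  have := le_lt_trans sc cr; rewrite ltr_pdivlMr// => /ltW; apply: le_trans.
  by rewrite ler_wpM2l// lerDl.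
(* Where c vanishes the identity holds for any value of m; the limit is the one
   that convergence requires. *)
pose m t := if c t == 0 then 'D_e g y : R else (g (q t + c t *: e) - g (q t)) / c t.
exists m; last first.
  apply: nearW => t; rewrite /m; case: eqP => [->|/eqP ct].
    by rewrite scale0r addr0 subrr mulr0.
  by rewrite divfK.
apply/cvgrPdist_lt => eps eps0.
move/cvgrPdist_lt : cDg => /(_ _ eps0) Dge.
have := near_seg _ (@filterI _ (nbhs y) (nbhs_filter y) _ _ dg Dge).
apply: (@filterS _ F FF) => t H.
have [s sc Hs] := @mvt_direction R E g (q t) e (c t) (fun s sc => (H s sc).1).
rewrite /m; case: eqP => [ct|/eqP ct]; first by rewrite subrr normr0.
by rewrite Hs mulfK//; exact: (H s sc).2.
Qed.

(** A finite basis with its dual, for spaces such as the model space of a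
    product manifold, which is not a space of row vectors. *)
Record coords (R : realType) (E : normedModType R) := Coords {
  cdim : nat ;
  cvec : 'I_cdim -> E ;
  ccoord : 'I_cdim -> E -> R ;
  ccoord_continuous : forall j, continuous (ccoord j) ;
  ccoord_linear : forall j a x y,
    ccoord j (a *: x + y) = a * ccoord j x + ccoord j y ;
  ccoordE : forall x, x = \sum_j ccoord j x *: cvec j }.

Arguments cvec {R E} c j.
Arguments ccoord {R E} c j x.

(** The increment of g along phi is telescoped over the coordinates, each step
    moving in a single basis direction; continuous partial derivatives thus
    suffice and no Frechet derivative appears. *)
Lemma is_derive_comp (R : realType) (E1 E2 : normedModType R) (C : coords E2)
    (g : E2 -> R^o) (phi : E1 -> E2) (x v : E1) (d : 'I_(cdim C) -> R) :
  (forall j, \forall z \near phi x, derivable g z (cvec C j)) ->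
  (forall j, {for phi x, continuous ('D_(cvec C j) g)}) ->
  (forall j, is_derive x v (ccoord C j \o phi : E1 -> R^o) (d j)) ->
  is_derive x v (g \o phi : E1 -> R^o)
    (\sum_j d j * 'D_(cvec C j) g (phi x)).
Proof.
move=> dg cg dphi.
pose c j (h : R) : R := ccoord C j (phi (h *: v + x)) - ccoord C j (phi x).
have dc j : (h^-1 * c j h) @[h --> 0^'] --> d j.
  by have [/[swap] <-] := dphi j; apply.
have c0 j : c j h @[h --> 0^'] --> (0 : R).
  have id0 : h @[h --> (0 : R)^'] --> (0 : R) by exact: cvg_within.
  have : (h * (h^-1 * c j h)) @[h --> (0 : R)^'] --> 0 * d j by exact: cvgM.
  rewrite mul0r; apply: cvg_near_eq; near=> h.
  rewrite /= mulrA mulfV ?mul1r//.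
  by near: h; exact: nbhs_dnbhs_neq.
(* p r h changes only the coordinates listed in r; for the full list it is
   phi (h *: v + x). *)
pose p r h := phi x + \sum_(j <- r) c j h *: cvec C j.
have p0 r : p r h @[h --> 0^'] --> phi x.
  have s0 : (\sum_(j <- r) c j h *: cvec C j) @[h --> (0 : R)^'] --> (0 : E2).
    elim: r => [|j r IH].
      by under eq_fun do rewrite big_nil; exact: cvg_cst.
    under eq_fun do rewrite big_cons.
    have : (c j h *: cvec C j + \sum_(j <- r) c j h *: cvec C j)
        @[h --> (0 : R)^'] --> 0 *: cvec C j + 0.
      by apply: cvgD => //; exact: cvgZr_tmp.
    by rewrite scale0r addr0.
  have : p r h @[h --> (0 : R)^'] --> phi x + 0.
    by apply: cvgD => //; exact: cvg_cst.
  by rewrite addr0.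
have main r : (h^-1 * (g (p r h) - g (phi x))) @[h --> 0^'] -->
     (\sum_(j <- r) d j * 'D_(cvec C j) g (phi x) : R).
  elim: r => [|j r IH].
    rewrite big_nil; under eq_fun do rewrite /p big_nil addr0 subrr mulr0.
    exact: cvg_cst.
  rewrite big_cons.
  have [m mD Hm] := increment (dg j) (cg j) (p0 r) (c0 j).
  have : (h^-1 * c j h * m h + h^-1 * (g (p r h) - g (phi x))) @[h --> 0^'] -->
      d j * 'D_(cvec C j) g (phi x) +
      \sum_(j <- r) d j * 'D_(cvec C j) g (phi x).
    by apply: cvgD => //; exact: cvgM.
  apply: cvg_near_eq.
  near=> h.
  rewrite /= {1}/p big_cons addrCA -/(p r h) addrC.
  rewrite -[g _ - g (phi x)](subrKA (g (p r h))) mulrDr (near Hm h)//.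
  by rewrite -mulrA [c j h * _]mulrC.
have pE h : p (index_enum 'I_(cdim C)) h = phi (h *: v + x).
  rewrite /p [in RHS](ccoordE C (phi (h *: v + x))) {1}(ccoordE C (phi x)) -big_split/=.
  by apply: eq_bigr => j _; rewrite -scalerDl addrC subrK.
have {main} := main (index_enum 'I_(cdim C)).
under eq_fun do rewrite pE.
move=> H; apply: DeriveDef; last exact: cvg_lim.
by apply/cvg_ex; eexists; exact: H.
Unshelve. all: by end_near. Qed.

Lemma coords_continuous (R : realType) (T : topologicalType)
    (E : normedModType R) (C : coords E) (phi : T -> E) x :
  (forall j : 'I_(cdim C), {for x, continuous (ccoord C j \o phi)}) ->
  {for x, continuous phi}.
Proof.
move=> cphi.
rewrite (_ : phi = fun y => \sum_j ccoord C j (phi y) *: cvec C j); last first.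
  by apply/funext => y; exact: ccoordE.
rewrite /prop_for /continuous_at; elim: (index_enum _) => [|j r IH].
  by under eq_fun do rewrite big_nil; rewrite big_nil; exact: cvg_cst.
under eq_fun do rewrite big_cons; rewrite big_cons; apply: cvgD => //.
by apply: cvgZr_tmp; exact: cphi.
Qed.

Section composition.
Variables (R : realType) (E1 E2 : normedModType R) (C : coords E2).
Variables (W1 : set E1) (W2 : set E2) (phi : E1 -> E2).
Hypotheses (oW1 : open W1) (oW2 : open W2) (phiW : forall x, W1 x -> W2 (phi x)).
Hypothesis sphi :
  forall j : 'I_(cdim C), smooth_in W1 (ccoord C j \o phi : E1 -> R^o).

Let dphi (j : 'I_(cdim C)) v := 'D_v (ccoord C j \o phi : E1 -> R^o).

Lemma smooth_is_derive_comp (f : E2 -> R^o) v x : smooth_in W2 f -> W1 x ->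
  is_derive x v (f \o phi : E1 -> R^o)
    (\sum_j dphi j v x * 'D_(cvec C j) f (phi x)).
Proof.
move=> sf Wx; apply: is_derive_comp => j.
- have := open_nbhs_nbhs (conj oW2 (phiW Wx)).
  by apply: filterS => z; exact: smooth_in_derivable.
- by apply: smooth_in_continuous (phiW Wx); exact: smooth_in_derive.
- by apply: derivableP; exact: (smooth_in_derivable (sphi j) Wx).
Qed.

(** The smooth functions on W1 together with the composites h o phi generate
    a set that is stable under derivation. *)
Lemma smooth_in_comp (f : E2 -> R^o) :
  smooth_in W2 f -> smooth_in W1 (f \o phi : E1 -> R^o).
Proof.
move=> sf.
pose G := [set g | smooth_in W1 (g : E1 -> R^o)] `|`
  [set g \o phi | g in [set g : E2 -> R^o | smooth_in W2 g]].
apply: (smooth_in_algebra oW1 (G := G)); last by apply: alg_gen; right; exists f.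
  move=> g x [sg|[h sh <-]] Wx; first exact: smooth_in_continuous sg Wx.
  apply: continuous_comp; last exact: smooth_in_continuous sh (phiW Wx).
  apply: (coords_continuous (C := C)) => j.
  exact: smooth_in_continuous (sphi j) Wx.
move=> g v [sg|[h sh <-]].
  exists ('D_v (g : E1 -> R^o)).
    by apply: alg_gen; left; exact: smooth_in_derive.
  by move=> x Wx; apply: derivableP; exact: (smooth_in_derivable sg Wx).
exists (fun x => \sum_j dphi j v x * 'D_(cvec C j) h (phi x)).
  apply: alg_sum => j; apply: alg_mul.
    by apply: alg_gen; left; exact: smooth_in_derive.
  by apply: alg_gen; right; exists ('D_(cvec C j) h); [exact: smooth_in_derive|].
by move=> x Wx; exact: smooth_is_derive_comp.
Qed.

(** The Faa di Bruno formula without its combinatorics: all that is used is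
    that the coefficients a are smooth and do not depend on f.  Uniformity in f
    makes it applicable to nets, and to the definition of differential
    operators. *)
Lemma dirD_comp (vs : seq E1) :
  exists (I : finType) (a : I -> E1 -> R) (ws : I -> seq E2),
    (forall i, smooth_in W1 (a i : E1 -> R^o)) /\
    forall f : E2 -> R^o, smooth_in W2 f -> forall x, W1 x ->
      dirD vs (f \o phi : E1 -> R^o) x =
      \sum_i a i x * dirD (ws i) f (phi x).
Proof.
elim: vs => [|v vs [I [a [ws [sa IH]]]]].
  exists 'I_1, (fun _ _ => 1), (fun=> [::]); split=> [_|f sf x Wx].
    exact: smooth_in_cst.
  by rewrite big_ord1 mul1r.
(* Leibniz: D_v falls either on a coefficient, or on (D^ws f) o phi, where the
   chain rule adds one basis direction to ws. *)
exists (I + I * 'I_(cdim C))%type,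
  (fun i => match i with
    | inl i => 'D_v (a i : E1 -> R^o)
    | inr ij => fun x => a ij.1 x * dphi ij.2 v x end),
  (fun i => match i with
    | inl i => ws i
    | inr ij => cvec C ij.2 :: ws ij.1 end).
split=> [[i|ij]|f sf x Wx].
- exact: smooth_in_derive.
- apply: smooth_inM => //; exact: smooth_in_derive.
rewrite big_sumType/= -(pair_bigA _ (fun i j => a i x * dphi j v x *
  dirD (cvec C j :: ws i) f (phi x))) -big_split/=.
have Hx : {in W1, dirD vs (f \o phi : E1 -> R^o) =1
    \sum_i (fun x => a i x * dirD (ws i) f (phi x) : R^o)}.
  by move=> y /[!inE] Wy; rewrite IH// fct_sumE.
rewrite (near_eq_derive _ (nbhs_eq_on oW1 Wx Hx)).
pose d i := a i x * \sum_j dphi j v x * 'D_(cvec C j) (dirD (ws i) f) (phi x) +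
  dirD (ws i) f (phi x) * 'D_v (a i : E1 -> R^o) x.
suff : is_derive x v (\sum_i (fun x => a i x * dirD (ws i) f (phi x) : R^o)) (\sum_i d i).
  move=> /(@derive_val _ _ _ _ _ _ _) ->; apply: eq_bigr => i _.
  rewrite /d addrC; congr (_ + _); last exact: mulrC.
  by rewrite mulr_sumr; apply: eq_bigr => j _; rewrite mulrA.
elim/big_ind2 : _ => [|f1 d1 f2 d2 h1 h2|i _].
- exact: is_derive_cst.
- exact: is_deriveD.
- apply: is_deriveM.
    by apply: derivableP; exact: (smooth_in_derivable (sa i) Wx).
  by apply: smooth_is_derive_comp Wx; exact: smooth_in_dirD.
Qed.

End composition.

(** * Coordinates, charts and the product atlas *)

Section coordinate_spaces.
Variable R : realType.

Lemma rV_coordE n (x : 'rV[R]_n) : x = \sum_j x 0 j *: delta_mx 0 j.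
Proof. exact: row_sum_delta. Qed.

Lemma rV_coord_linear n (j : 'I_n) a (x y : 'rV[R]_n) :
  (a *: x + y) 0 j = a * x 0 j + y 0 j.
Proof. by rewrite !mxE. Qed.

Lemma rV_coord_continuous n (j : 'I_n) :
  continuous (fun x : 'rV[R]_n => x 0 j).
Proof. exact: coord_continuous. Qed.

Definition rV_coords n : coords 'rV[R]_n :=
  Coords (@rV_coord_continuous n) (@rV_coord_linear n) (@rV_coordE n).

Variables (E : normedModType R) (C : coords E).

Definition prod_ccoord (j : 'I_(cdim C).+1) (p : R * E) : R :=
  if unlift ord0 j is Some i then ccoord C i p.2 else p.1.

Definition prod_cvec (j : 'I_(cdim C).+1) : R * E :=
  if unlift ord0 j is Some i then (0, cvec C i) else (1, 0).

Lemma prod_ccoord_continuous j : continuous (prod_ccoord j).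
Proof.
move=> p; rewrite /prod_ccoord; case: (unlift ord0 j) => [i|].
  apply: (continuous_comp (f := snd)); first exact: cvg_snd.
  exact: ccoord_continuous.
exact: cvg_fst.
Qed.

Lemma prod_ccoord_linear j a (p q : R * E) :
  prod_ccoord j (a *: p + q) = a * prod_ccoord j p + prod_ccoord j q.
Proof.
by rewrite /prod_ccoord; case: (unlift ord0 j) => [i|] //=; rewrite ccoord_linear.
Qed.

Lemma prod_ccoordE (p : R * E) : p = \sum_j prod_ccoord j p *: prod_cvec j.
Proof.
rewrite big_ord_recl /prod_ccoord /prod_cvec unlift_none.
under eq_bigr do rewrite liftK.
case: p => t x /=.
have -> : \sum_(i < cdim C) ccoord C i x *: ((0, cvec C i) : R * E) = (0, x).
  rewrite [in RHS](ccoordE C x).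
  elim/big_ind2 : _ => // [a1 b1 a2 b2 -> -> | i _].
    by apply/pair_eqP; rewrite /= addr0 !eqxx.
  by apply/pair_eqP; rewrite /= scaler0 !eqxx.
by apply/pair_eqP; rewrite /= scaler0 add0r addr0 /GRing.scale/= mulr1 !eqxx.
Qed.

Definition prod_coords : coords (R * E)%type :=
  Coords prod_ccoord_continuous prod_ccoord_linear prod_ccoordE.

Lemma prod_coordsP (P : (R * E -> R) -> Prop) :
  P fst -> (forall i, P (fun p => ccoord C i p.2)) ->
  forall j, P (ccoord prod_coords j).
Proof.
move=> P1 P2 j /=; rewrite /prod_ccoord.
by case: (unlift ord0 j) => [i|]; [exact: P2|exact: P1].
Qed.

End coordinate_spaces.

(** Continuous linear forms commute with derivation. *)
Lemma is_derive_ccoord (R : realType) (E1 E2 : normedModType R) (C : coords E2)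
    (f : E1 -> E2) x v df j : is_derive x v f df ->
  is_derive x v (ccoord C j \o f : E1 -> R^o) (ccoord C j df).
Proof.
move=> [dfx <-]; have linj := ccoord_linear j.
have l0 : ccoord C j 0 = 0.
  by have := linj (-1) 0 0; rewrite scaler0 addr0 mulN1r addNr.
have : (ccoord C j (h^-1 *: ((f \o shift x) (h *: v) - f x)) : R^o) @[h --> 0^'] -->
     (ccoord C j ('D_v f x) : R^o).
  by apply: continuous_cvg dfx; exact: ccoord_continuous.
have -> : (fun h => ccoord C j (h^-1 *: ((f \o shift x) (h *: v) - f x)) : R^o) =
  (fun h => h^-1 *: (((ccoord C j \o f) \o shift x) (h *: v) - (ccoord C j \o f) x) : R^o).
  apply/funext => h; rewrite -[X in ccoord C j X]addr0 linj l0 addr0; congr (_ * _).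
  by rewrite addrC -scaleN1r linj mulN1r addrC.
by move=> H; apply: DeriveDef; [apply/cvg_ex; eexists; exact: H|exact: cvg_lim].
Qed.

Lemma smooth_in_ccoord (R : realType) (E1 E2 : normedModType R) (C : coords E2)
    (W : set E1) (f : E1 -> E2) j :
  open W -> smooth_in W f -> smooth_in W (ccoord C j \o f : E1 -> R^o).
Proof.
move=> oW sf.
pose P := [set (ccoord C j \o g : E1 -> R^o) | g in smooth_in W].
apply: (smooth_in_stable oW (P := P)); last by exists f.
  move=> _ x [g sg <-] Wx; apply: continuous_comp.
    exact: smooth_in_continuous sg Wx.
  exact: ccoord_continuous.
move=> _ v [g sg <-]; exists (ccoord C j \o 'D_v g).
  by exists ('D_v g) => //; exact: smooth_in_derive.
move=> x Wx; apply: is_derive_ccoord; apply: derivableP.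
exact: smooth_in_derivable sg Wx.
Qed.

Section coordinate_atlases.
Variables (R : realType) (E : normedModType R) (C : coords E).
Variables (X : topologicalType) (A : set (chart E X)).

(** Smoothness of the changes of charts, stated for their components: this is
    what [dirD_comp] consumes, and it passes to the product atlas without
    vector-valued calculus. *)
Definition coord_atlas : Prop :=
  (forall c, A c -> is_chart c) /\
  forall c d, A c -> A d -> forall j,
    smooth_in (cmap c @` (cdom c `&` cdom d))
      (fun z => ccoord C j (cmap d (cinv c z)) : R^o).

Lemma chart_image_open (c : chart E X) (W : set X) :
  is_chart c -> open W -> open (cmap c @` (W `&` cdom c)).
Proof.
move=> [oc oi cK cc ic] oW; rewrite openE => _ [x [Wx cx] <-].
have ny : nbhs (cmap c x) (cmap c @` cdom c).
  by apply: open_nbhs_nbhs; split => //; exists x.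
have nW : nbhs (cmap c x) (cinv c @^-1` W).
  apply: ic; first by exists x.
  by rewrite cK//; apply: open_nbhs_nbhs; split.
rewrite /interior; apply: filterS2 ny nW => y [z cz <-] /=.
by rewrite cK// => Wz; exists z.
Qed.

Lemma chart_imageE (c : chart E X) (W : set X) :
  W `<=` cdom c -> cmap c @` W = cmap c @` (W `&` cdom c).
Proof. by move=> /setIidl ->. Qed.

Lemma smooth_atlas_coord : smooth_atlas A -> coord_atlas.
Proof.
move=> [chA _ trA]; split=> // c d Ac Ad j.
apply: (smooth_in_ccoord j (f := cmap d \o cinv c)); last exact: trA.
rewrite setIC; apply: chart_image_open; first exact: chA.
by have [] := chA d Ad.
Qed.

End coordinate_atlases.

Lemma open_preimage_snd (S T : topologicalType) (V : set T) :
  open V -> open [set p : S * T | V p.2].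
Proof.
by move=> oV; apply: (open_comp (f := snd)) => // p _; exact: cvg_snd.
Qed.

Lemma cvg_pair_to (I : Type) (F : set_system I) {FF : Filter F}
    (S T : topologicalType) (f : I -> S) (g : I -> T) (a : S) (b : T) :
  f @ F --> a -> g @ F --> b -> (fun i => (f i, g i)) @ F --> (a, b).
Proof. by move=> fa gb; exact: cvg_pair. Qed.

Lemma continuous_pair (S T U : topologicalType) (f : S -> T) (g : S -> U) x :
  {for x, continuous f} -> {for x, continuous g} ->
  {for x, continuous (fun y => (f y, g y))}.
Proof. by move=> cf cg; exact: cvg_pair. Qed.

Section product_atlas.
Variables (R : realType) (E : normedModType R) (C : coords E).
Variables (X : topologicalType) (A : set (chart E X)).

Lemma prod_is_chart (c : chart E X) : is_chart c -> is_chart (prod_chart c).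
Proof.
move=> [oc oi cK cc ic].
have imE : cmap (prod_chart c) @` cdom (prod_chart c) =
    snd @^-1` (cmap c @` cdom c).
  apply/seteqP; split=> [_ [[t x] /= cx <-]|[t y] /= [x cx <-]] /=.
    by exists x.
  by exists (t, x).
split.
- exact: open_preimage_snd.
- by rewrite imE; exact: open_preimage_snd.
- by move=> [t x] /= cx; rewrite cK.
- move=> [t x] /= cx; apply: continuous_pair; first exact: cvg_fst.
  by apply: (continuous_comp (f := snd)); [exact: cvg_snd|exact: cc].
- rewrite imE => -[t y] /= iy; apply: continuous_pair; first exact: cvg_fst.
  by apply: (continuous_comp (f := snd)); [exact: cvg_snd|exact: ic].
Qed.

Lemma smooth_in_fst (W : set (R * E)) :
  open W -> smooth_in W (fst : R * E -> R^o).
Proof.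
move=> oW; apply: smooth_in_linear => //; first by move=> p; exact: cvg_fst.
Qed.

Lemma smooth_in_comp_snd (W : set (R * E)) (V : set E) (f : E -> R^o) :
  open W -> open V -> (forall p, W p -> V p.2) -> smooth_in V f ->
  smooth_in W (fun p => f p.2 : R^o).
Proof.
move=> oW oV WV; apply: (smooth_in_comp (C := C) (phi := snd)) => // j.
apply: smooth_in_linear => //.
  by move=> p; apply: (continuous_comp (f := snd)); [exact: cvg_snd|exact: ccoord_continuous].
by move=> a p q; rewrite /= ccoord_linear.
Qed.

Lemma prod_coord_atlas : coord_atlas C A ->
  coord_atlas (prod_coords C) (prod_atlas A).
Proof.
move=> [chA trA]; split=> [_ [c Ac <-]|_ _ [c Ac <-] [d Ad <-] j].
  by apply: prod_is_chart; exact: chA.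
have oW : open (cmap (prod_chart c) @` (cdom (prod_chart c) `&` cdom (prod_chart d))).
  rewrite setIC; apply: chart_image_open; first exact/prod_is_chart/chA.
  by have [] := prod_is_chart (chA d Ad).
have oV : open (cmap c @` (cdom c `&` cdom d)).
  rewrite setIC; apply: chart_image_open; first exact/chA.
  by have [] := chA d Ad.
apply: (prod_coordsP (P := fun l => smooth_in _
  (fun z => l (cmap (prod_chart d) (cinv (prod_chart c) z)) : R^o))) => /=.
  exact: smooth_in_fst.
move=> i; apply: (smooth_in_comp_snd (V := cmap c @` (cdom c `&` cdom d))
  (f := fun z => ccoord C i (cmap d (cinv c z)))) => //; last exact: trA.
by move=> _ [[t x] /= cdx <-]; exists x.
Qed.

End product_atlas.

(** * Moderate and negligible nets in one chart *)

Section asymptotics.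
Variables (R : realType) (T : Type).
Implicit Types (K : set T) (w : R -> T -> R) (r : R -> R).

Definition big_O_on K r w : Prop :=
  exists C : R, \forall e \near 0^'+, forall x, K x -> `|w e x| <= C * r e.

(** The two kinds of nets are treated at once: b = true stands for negligible
    nets, b = false for moderate ones. *)
Definition asymptotic (b : bool) K w : Prop :=
  if b then forall m : nat, big_O_on K (fun e => e ^+ m) w
  else exists N : nat, big_O_on K (fun e => e ^- N) w.

Lemma near_unit : \forall e \near (0 : R)^'+, 0 < e <= 1.
Proof.
near=> e; apply/andP; split; near: e; first exact: nbhs_right_gt.
exact: nbhs_right_le.
Unshelve. all: by end_near. Qed.

Lemma big_O_on_eq K r w w' :
  (forall e, 0 < e <= 1 -> forall x, K x -> w e x = w' e x) ->
  big_O_on K r w' -> big_O_on K r w.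
Proof.
move=> ww' [C HC]; exists C; near=> e => x Kx.
rewrite ww' //; last by near: e; exact: near_unit.
by move: x Kx; near: e.
Unshelve. all: by end_near. Qed.

Lemma big_O_on0 K r : big_O_on K r (fun _ _ => 0).
Proof.
by exists 0; near=> e => x _; rewrite normr0 mul0r.
Unshelve. all: by end_near. Qed.

Lemma big_O_onD K r w w' :
  big_O_on K r w -> big_O_on K r w' -> big_O_on K r (fun e x => w e x + w' e x).
Proof.
move=> [C HC] [C' HC']; exists (C + C'); near=> e => x Kx.
rewrite (le_trans (ler_normD _ _))// mulrDl lerD//.
  by move: x Kx; near: e.
by move: x Kx; near: e.
Unshelve. all: by end_near. Qed.

Lemma big_O_onM K r w (a : T -> R) (M : R) :
  (forall x, K x -> `|a x| <= M) -> big_O_on K r w ->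
  big_O_on K r (fun e x => a x * w e x).
Proof.
move=> aM [C HC]; exists (M * C); near=> e => x Kx.
by rewrite normrM -mulrA ler_pM//; [exact: aM|move: x Kx; near: e].
Unshelve. all: by end_near. Qed.

Lemma big_O_on_power K (N N' : nat) w : (N <= N')%N ->
  big_O_on K (fun e => e ^- N) w -> big_O_on K (fun e => e ^- N') w.
Proof.
move=> NN' [C HC]; exists `|C|; near=> e => x Kx.
have /andP[e0 e1] : 0 < e <= 1 by near: e; exact: near_unit.
apply: (@le_trans _ _ (C * e ^- N)); first by move: x Kx; near: e.
apply: (le_trans (ler_norm _)); rewrite normrM ler_wpM2l//.
rewrite ger0_norm; last by rewrite invr_ge0 exprn_ge0// ltW.
by rewrite lef_pV2 ?posrE ?exprn_gt0// ler_wiXn2l// ltW.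
Unshelve. all: by end_near. Qed.

Lemma asymptotic_eq b K w w' :
  (forall e, 0 < e <= 1 -> forall x, K x -> w e x = w' e x) ->
  asymptotic b K w' -> asymptotic b K w.
Proof.
move=> ww'; case: b => [H m|[N H]]; first exact: big_O_on_eq (H m).
by exists N; exact: big_O_on_eq H.
Qed.

Lemma asymptotic0 b K : asymptotic b K (fun _ _ => 0).
Proof. by case: b => [m|]; [|exists 0%N]; exact: big_O_on0. Qed.

(** For moderate nets the two orders of growth are replaced by their
    maximum. *)
Lemma asymptoticD b K w w' : asymptotic b K w -> asymptotic b K w' ->
  asymptotic b K (fun e x => w e x + w' e x).
Proof.
case: b => [H H' m|[N H] [N' H']]; first exact: big_O_onD.
exists (maxn N N'); apply: big_O_onD.
  by apply: big_O_on_power H; rewrite leq_maxl.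
by apply: big_O_on_power H'; rewrite leq_maxr.
Qed.

Lemma asymptoticM b K w (a : T -> R) (M : R) :
  (forall x, K x -> `|a x| <= M) -> asymptotic b K w ->
  asymptotic b K (fun e x => a x * w e x).
Proof.
move=> aM; case: b => [H m|[N H]]; first exact: big_O_onM aM (H m).
by exists N; exact: big_O_onM aM H.
Qed.

Lemma asymptotic_sum b K (I : finType) (w : I -> R -> T -> R) (a : I -> T -> R) :
  (forall i, exists M, forall x, K x -> `|a i x| <= M) ->
  (forall i, asymptotic b K (w i)) ->
  asymptotic b K (fun e x => \sum_i a i x * w i e x).
Proof.
move=> aM Hw; elim: (index_enum I) => [|i s IH].
  by apply: asymptotic_eq (asymptotic0 b K) => e _ x _; rewrite big_nil.
have [M iM] := aM i.
apply: asymptotic_eq (asymptoticD (asymptoticM iM (Hw i)) IH) => e _ x _.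
by rewrite big_cons.
Qed.

End asymptotics.

Lemma asymptotic_comp (R : realType) (S T : Type) b (K : set S) (F : S -> T)
    (w : R -> T -> R) :
  asymptotic b (F @` K) w -> asymptotic b K (fun e x => w e (F x)).
Proof.
have H r : big_O_on (F @` K) r w -> big_O_on K r (fun e x => w e (F x)).
  by move=> [C HC]; exists C; apply: filterS HC => e He x Kx; apply: He; exists x.
by case: b => [Hw m|[N Hw]]; [exact: H|exists N; exact: H].
Qed.

Definition net_of (b : bool) (R : realType) (E : normedModType R)
    (X : topologicalType) (A : set (chart E X)) (W : set X) (u : R -> X -> R) : Prop :=
  if b then Defs.negligible A W u else moderate A W u.

Lemma compact_continuous_bounded (R : realType) (X : topologicalType) (K : set X)
    (a : X -> R) : compact K -> (forall x, K x -> {for x, continuous a}) ->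
  exists M, forall x, K x -> `|a x| <= M.
Proof.
move=> cK ca; have : bounded_set (a @` K : set R^o).
  apply: compact_bounded; apply: continuous_compact => //.
  by apply: continuous_in_subspaceT => x /[!inE]; exact: ca.
move=> [M [_ HM]]; exists (M + 1) => x Kx.
by apply: (HM (M + 1)); [rewrite ltrDl|exists x].
Qed.

Section one_chart.
Variables (R : realType) (E : normedModType R) (C : coords E).
Variables (X : topologicalType) (A : set (chart E X)) (hA : coord_atlas C A).
Variables (c : chart E X) (Ac : A c) (W : set X) (oW : open W) (Wc : W `<=` cdom c).

Lemma chart_domain_open : open (cmap c @` W).
Proof. by rewrite (chart_imageE Wc); apply: chart_image_open => //; exact: hA.1. Qed.

Let cK x : cdom c x -> cinv c (cmap c x) = x.
Proof. by have [_ _ + _ _] := hA.1 c Ac; apply. Qed.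

Section other_chart.
Variables (d : chart E X) (Ad : A d).
Let dK x : cdom d x -> cinv d (cmap d x) = x.
Proof. by have [_ _ + _ _] := hA.1 d Ad; apply. Qed.
Let Wd := W `&` cdom d.
Let oWd : open Wd.
Proof. by apply: openI => //; have [] := hA.1 d Ad. Qed.

Let odW : open (cmap d @` Wd).
Proof. by apply: chart_image_open => //; exact: hA.1. Qed.
Let ocW : open (cmap c @` Wd).
Proof.
rewrite chart_imageE; last by move=> x [/Wc].
by apply: chart_image_open => //; exact: hA.1.
Qed.

Let phi_dc z : (cmap d @` Wd) z -> (cmap c @` Wd) (cmap c (cinv d z)).
Proof. by move=> [x [Wx dx] <-]; exists x => //; rewrite dK. Qed.
Let phi_cd z : (cmap c @` Wd) z -> (cmap d @` Wd) (cmap d (cinv c z)).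
Proof. by move=> [x [Wx dx] <-]; exists x => //; rewrite cK//; exact: Wc. Qed.

Let s_dc j : smooth_in (cmap d @` Wd) (ccoord C j \o (cmap c \o cinv d) : E -> R^o).
Proof.
apply: smooth_inS (hA.2 d c Ad Ac j) => _ [x [Wx dx] <-].
by exists x => //; split=> //; exact: Wc.
Qed.
Let s_cd j : smooth_in (cmap c @` Wd) (ccoord C j \o (cmap d \o cinv c) : E -> R^o).
Proof.
apply: smooth_inS (hA.2 c d Ac Ad j) => _ [x [Wx dx] <-].
by exists x => //; split=> //; exact: Wc.
Qed.

Lemma smooth_in_change_chart (f : E -> R^o) : smooth_in (cmap c @` Wd) f ->
  smooth_in (cmap d @` Wd) (f \o (cmap c \o cinv d) : E -> R^o).
Proof. exact: (smooth_in_comp odW ocW phi_dc s_dc). Qed.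

Lemma smooth_on_change_chart (f : X -> R) :
  smooth_in (cmap c @` W) (f \o cinv c : E -> R^o) ->
  smooth_in (cmap d @` Wd) (f \o cinv d : E -> R^o).
Proof.
move=> sf; apply: (smooth_in_eq (f := (f \o cinv c) \o (cmap c \o cinv d))) => //.
  by move=> z /[!inE] -[x [Wx dx] <-] /=; rewrite dK// cK//; exact: Wc.
apply: smooth_in_change_chart; apply: smooth_inS sf.
by move=> _ [x [Wx _] <-]; exists x.
Qed.

(** [dirD_comp] for the change of charts from c to d: the derivatives in the
    chart c are differential operators in any other chart of the atlas. *)
Lemma dirD_change_chart (vs : seq E) :
  exists (k : nat) (a : 'I_k -> X -> R) (ws : 'I_k -> seq E),
    (forall i, smooth_in (cmap d @` Wd) (a i \o cinv d : E -> R^o)) /\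
    forall f : X -> R, smooth_on A W (f : X -> R^o) ->
    forall x, W x -> cdom d x ->
      dirD vs (f \o cinv c : E -> R^o) (cmap c x) =
      \sum_(i < k) a i x * dirD (ws i) (f \o cinv d : E -> R^o) (cmap d x).
Proof.
have [I [a [ws [sa H]]]] := dirD_comp ocW odW phi_cd s_cd vs.
exists #|I|, (fun i x => a (enum_val i) (cmap c x)), (fun i => ws (enum_val i)).
split=> [i|f sf x Wx dx]; first exact: smooth_in_change_chart.
have cWx : (cmap c @` Wd) (cmap c x) by exists x.
have /dirD_eq -> : {in cmap c @` Wd, f \o cinv c =1 (f \o cinv d) \o (cmap d \o cinv c)}.
- by move=> z /[!inE] -[y [Wy dy] <-] /=; rewrite cK ?dK//; exact: Wc.
- rewrite H//; last exact: sf.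
  (* Differential operators are indexed by ordinals, hence the enumeration of I. *)
  transitivity (\sum_(i in I) a i (cmap c x) *
      dirD (ws i) (f \o cinv d : E -> R^o) (cmap d x)); last exact: big_enum_val.
  by apply: eq_big => [i|i _ /=]; [rewrite inE|rewrite cK//; exact: Wc].
- exact: ocW.
- by rewrite inE.
Qed.

End other_chart.

Lemma smooth_onP (f : X -> R) :
  smooth_on A W (f : X -> R^o) <->
  smooth_in (cmap c @` W) (f \o cinv c : E -> R^o).
Proof.
split=> [/(_ c Ac)|sf d Ad]; first by rewrite -chart_imageE.
exact: smooth_on_change_chart.
Qed.

(** It is for this lemma that W has to lie in the domain of c: the operator is
    then defined on all of W without a cut-off function. *)
Lemma chart_diff_op (vs : seq E) :
  diff_op A W (fun f x => dirD vs (f \o cinv c : E -> R^o) (cmap c x)).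
Proof. by move=> d Ad; exact: dirD_change_chart. Qed.

(** One direction tests the net on the operators of [chart_diff_op]; in the
    other one the coefficients of an arbitrary operator in the chart c are
    bounded on compact sets. *)
Lemma net_ofP b (u : R -> X -> R) :
  net_of b A W u <->
  (forall e, 0 < e <= 1 -> smooth_in (cmap c @` W) (u e \o cinv c : E -> R^o)) /\
  forall K vs, compact K -> K `<=` W ->
    asymptotic b K (fun e x => dirD vs (u e \o cinv c : E -> R^o) (cmap c x)).
Proof.
have -> : net_of b A W u <-> smooth_net A W u /\
   forall K P, compact K -> K `<=` W -> diff_op A W P ->
     asymptotic b K (fun e x => P (u e) x).
  case: b => /=; split=> -[su H]; split=> //.
  - by move=> K P cpK KW dP m; exact: H.
  - by move=> K P m cpK KW dP; exact: H.
split=> -[su H]; split.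
- by move=> e e01; exact: (smooth_onP (u e)).1 (su e e01).
- by move=> K vs cpK KW; exact: (H K _ cpK KW (chart_diff_op vs)).
- by move=> e e01; exact: (smooth_onP (u e)).2 (su e e01).
move=> K P cpK KW /(_ c Ac)[k [a [vs [sa Pa]]]].
apply: asymptotic_eq (asymptotic_sum _ _) => [e e01 x Kx|i|i].
- by apply: Pa; [exact: (smooth_onP (u e)).2 (su e e01)|exact: KW|exact/Wc/KW].
- apply: compact_continuous_bounded => // x Kx; have Wx := KW x Kx.
  have cx := Wc Wx.
  have [oc _ _ cc _] := hA.1 c Ac.
  have : {for x, continuous ((a i \o cinv c) \o cmap c)}.
    apply: continuous_comp; first exact: cc.
    by apply: smooth_in_continuous (sa i) _; exists x.
  apply: continuous_near_eq; have := open_nbhs_nbhs (conj oc cx).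
  by apply: filterS => y cy /=; rewrite cK.
- exact: H.
Qed.

Lemma net_of_eq b (u v : R -> X -> R) :
  (forall e, 0 < e <= 1 -> forall x, W x -> u e x = v e x) ->
  net_of b A W u -> net_of b A W v.
Proof.
move=> uv /net_ofP[su Hu].
have Huv e : 0 < e <= 1 -> {in cmap c @` W, u e \o cinv c =1 v e \o cinv c}.
  by move=> e01 z /[!inE] -[x Wx <-] /=; rewrite cK ?uv//; exact: Wc.
apply/net_ofP; split=> [e e01|K vs cpK KW].
  by apply: smooth_in_eq (su e e01); [exact: chart_domain_open|exact: Huv].
apply: asymptotic_eq (Hu K vs cpK KW) => e e01 x Kx; apply/esym.
apply: (dirD_eq _ chart_domain_open (Huv e e01)).
by rewrite inE; exists x => //; exact: KW.
Qed.

Lemma net_of0 b : net_of b A W (fun _ _ => 0).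
Proof.
have H vs : dirD vs ((fun=> 0) \o cinv c : E -> R^o) = cst 0.
  elim: vs => //= v vs ->; apply/funext => x; exact: derive_cst.
apply/net_ofP; split=> [e _|K vs _ _].
  exact: (smooth_in_cst 0 chart_domain_open).
by apply: (asymptotic_eq _ (@asymptotic0 R X b K)) => e _ x _; rewrite H.
Qed.

Lemma net_ofB b (u v : R -> X -> R) :
  net_of b A W u -> net_of b A W v -> net_of b A W (fun e x => u e x - v e x).
Proof.
move=> /net_ofP[su Hu] /net_ofP[sv Hv].
have oD := chart_domain_open.
have sB e : 0 < e <= 1 ->
    smooth_in (cmap c @` W) ((fun x => u e x - v e x) \o cinv c : E -> R^o).
  move=> e01; have : smooth_in (cmap c @` W)
      (fun z => (u e \o cinv c) z + (-1) * (v e \o cinv c) z : R^o).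
    apply: smooth_inD => //; first exact: su.
    by apply: smooth_inM => //; [exact: smooth_in_cst|exact: sv].
  by apply: smooth_in_eq => // z _ /=; rewrite mulN1r.
apply/net_ofP; split=> // K vs cpK KW.
have HB e : 0 < e <= 1 -> {in cmap c @` W,
    dirD vs ((fun x => u e x - v e x) \o cinv c : E -> R^o) =1
    dirD vs (u e \o cinv c : E -> R^o) - dirD vs (v e \o cinv c : E -> R^o)}.
  move=> e01; elim: vs => //= w ws IH z /[!inE] Wz.
  rewrite (near_eq_derive _ (nbhs_eq_on oD Wz IH)) deriveB//.
    exact: smooth_in_derivable (smooth_in_dirD ws (su e e01)) Wz.
  exact: smooth_in_derivable (smooth_in_dirD ws (sv e e01)) Wz.
have M1 x : K x -> `|(-1 : R)| <= 1 by rewrite normrN1.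
apply: asymptotic_eq (asymptoticD (Hu K vs cpK KW)
  (asymptoticM M1 (Hv K vs cpK KW))) => e e01 x Kx.
rewrite HB//; last by rewrite inE; exists x => //; exact: KW.
by rewrite mulN1r.
Qed.

Lemma net_ofD b (u v : R -> X -> R) :
  net_of b A W u -> net_of b A W v -> net_of b A W (fun e x => u e x + v e x).
Proof.
move=> nu nv; apply: net_of_eq (net_ofB nu (net_ofB (net_of0 b) nv)) => e _ x _.
by rewrite sub0r opprK.
Qed.

End one_chart.

Section pullback.
Variables (R : realType) (E E' : normedModType R) (C : coords E) (C' : coords E').
Variables (X X' : topologicalType) (A : set (chart E X)) (A' : set (chart E' X')).
Hypotheses (hA : coord_atlas C A) (hA' : coord_atlas C' A').
Variables (c : chart E X) (Ac : A c) (W : set X) (oW : open W) (Wc : W `<=` cdom c).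
Variables (c' : chart E' X') (Ac' : A' c') (W' : set X') (oW' : open W')
  (Wc' : W' `<=` cdom c').
Variable F : X -> X'.
Hypothesis FW : forall x, W x -> W' (F x).
Hypothesis cF : forall x, W x -> {for x, continuous F}.
Hypothesis sF : forall j, smooth_in (cmap c @` W)
  (fun z => ccoord C' j (cmap c' (F (cinv c z))) : R^o).

(** By [dirD_comp] the coordinate derivatives of u o F at x are combinations,
    with coefficients bounded on K, of those of u at F x, where F x ranges over
    the compact set F @` K. *)
Lemma net_of_pullback b (u : R -> X' -> R) :
  net_of b A' W' u -> net_of b A W (fun e x => u e (F x)).
Proof.
move=> /(net_ofP hA' Ac' oW' Wc')[su Hu]; apply/(net_ofP hA Ac oW Wc).
have cK x : cdom c x -> cinv c (cmap c x) = x.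
  by have [_ _ + _ _] := hA.1 c Ac; apply.
have cK' x : cdom c' x -> cinv c' (cmap c' x) = x.
  by have [_ _ + _ _] := hA'.1 c' Ac'; apply.
have oD := chart_domain_open hA Ac oW Wc.
have oD' := chart_domain_open hA' Ac' oW' Wc'.
pose phi z := cmap c' (F (cinv c z)).
have phiW z : (cmap c @` W) z -> (cmap c' @` W') (phi z).
  by move=> [x Wx <-]; exists (F x); [exact: FW|rewrite /phi cK//; exact: Wc].
have uphi e : {in cmap c @` W, (u e \o cinv c') \o phi =1 (fun x => u e (F x)) \o cinv c}.
  move=> z /[!inE] -[x Wx <-]; rewrite /phi /= cK; last exact: Wc.
  by rewrite cK'//; exact/Wc'/FW.
split=> [e e01|K vs cpK KW].
  apply: (smooth_in_eq oD (uphi e)).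
  exact: (smooth_in_comp oD oD' phiW sF (su e e01)).
have [I [a [ws [sa H]]]] := dirD_comp oD oD' phiW sF vs.
have cpFK : compact (F @` K).
  apply: continuous_compact => //.
  by apply: continuous_in_subspaceT => x /[!inE] /KW; exact: cF.
have FKW : F @` K `<=` W' by move=> _ [x /KW /FW Wx <-].
have := fun i => asymptotic_comp (Hu (F @` K) (ws i) cpFK FKW).
move=> /(asymptotic_sum (a := fun i x => a i (cmap c x))) {}Hu.
apply: asymptotic_eq (Hu _) => [e e01 x Kx|i].
  have Wx := KW x Kx; have Dx : (cmap c @` W) (cmap c x) by exists x.
  rewrite -(dirD_eq vs oD (uphi e)) ?inE// H//; last exact: su.
  by apply: eq_bigr => i _; rewrite /phi cK//; exact: Wc.
apply: compact_continuous_bounded => // x Kx; have Wx := KW x Kx.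
have [_ _ _ cc _] := hA.1 c Ac.
apply: (continuous_comp (f := cmap c) (g := a i)); first exact/cc/Wc.
by apply: smooth_in_continuous (sa i) _; exists x.
Qed.

End pullback.

(** * The scalar implicit function theorem *)

(** 0 = H (T (z + s v), z + s v) - H (T z, z) is the sum of the increment of H
    in the first variable, which is m(s) times the increment of T, and of the
    increment of H in the second variable; dividing by s m(s) gives the
    derivative of T. *)
Lemma implicit_function_derive (R : realType) (E : normedModType R) (W : set E)
    (H : R * E -> R^o) (T : E -> R) (z v : E) :
  open W -> W z -> (forall y, W y -> H (T y, y) = 0) -> {for z, continuous T} ->
  (\forall q \near (T z, z), derivable H q (1, 0)) ->
  {for (T z, z), continuous ('D_((1, 0) : R * E) H)} ->
  derivable H (T z, z) (0, v) -> 'D_((1, 0) : R * E) H (T z, z) != 0 ->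
  is_derive z v (T : E -> R^o)
    (- ('D_((0, v) : R * E) H (T z, z) / 'D_((1, 0) : R * E) H (T z, z))).
Proof.
move=> oW Wz HT cT dH cH dHv a0.
set a := 'D_((1, 0) : R * E) H (T z, z); set b := 'D_((0, v) : R * E) H (T z, z).
have zs : (s *: v + z) @[s --> (0 : R)^'] --> z.
  have : (s *: v + z) @[s --> (0 : R)^'] --> 0 *: v + z.
    apply: cvgD; last exact: cvg_cst.
    by apply: cvgZr_tmp; exact: cvg_within.
  by rewrite scale0r add0r.
pose c (s : R) : R := T (s *: v + z) - T z.
have c0 : c s @[s --> (0 : R)^'] --> (0 : R).
  have : c s @[s --> (0 : R)^'] --> T z - T z.
    by apply: cvgB; [exact: (cvg_comp _ _ zs cT)|exact: cvg_cst].
  by rewrite subrr.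
pose q (s : R) : R * E := (T z, s *: v + z).
have qz : q s @[s --> (0 : R)^'] --> (T z, z).
  by apply: cvg_pair_to => //; exact: cvg_cst.
have [m mD Hm] := increment dH cH qz c0.
have nW : \forall s \near (0 : R)^', W (s *: v + z).
  by apply: (zs W); apply: open_nbhs_nbhs.
have key : \forall s \near (0 : R)^',
    s^-1 * c s = - ((s^-1 * (H (q s) - H (T z, z))) / m s).
  have nm : \forall s \near (0 : R)^', m s != 0.
    exact: cvgr_neq0 mD a0.
  near=> s.
  have ms : m s != 0 by near: s.
  have Hs : H (q s + c s *: (1, 0)) - H (q s) = m s * c s by near: s.
  have E1 : q s + c s *: ((1, 0) : R * E) = (T (s *: v + z), s *: v + z).
    apply/pair_eqP; rewrite /q /c /= scaler0 addr0 /GRing.scale/= mulr1.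
    by rewrite addrC subrK !eqxx.
  move: Hs; rewrite E1 !HT//; last by near: s.
  rewrite sub0r subr0 => Hs.
  have -> : H (q s) = - (m s * c s) by rewrite -Hs opprK.
  by rewrite mulrN mulNr opprK mulrA mulrAC mulfK.
have Hb : (s^-1 * (H (q s) - H (T z, z))) @[s --> (0 : R)^'] --> (b : R).
  move: dHv; rewrite /derivable -/(derive H (T z, z) (0, v)) -/b; apply: cvg_trans.
  apply: near_eq_cvg; apply: nearW => s.
  congr (_ * (H _ - _)); apply/pair_eqP.
  by rewrite /q /= scaler0 add0r !eqxx.
have lim : (s^-1 *: (((T : E -> R^o) \o shift z) (s *: v) - T z)) @[s --> 0^'] -->
    (- (b / a) : R^o).
  apply: (cvg_near_eq key); apply: cvgN; exact: (cvgM Hb (cvgV a0 mD)).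
by apply: DeriveDef; [apply/cvg_ex; eexists; exact: lim|exact: cvg_lim].
Unshelve. all: by end_near. Qed.

(** The functions z |-> g (T z, z), with g smooth, generate a set that is
    stable under derivation, since D_v T is itself of this form by
    [implicit_function_derive].  T is the case where g is the first
    projection. *)
Lemma implicit_function_smooth (R : realType) (E : normedModType R)
    (C : coords E) (W : set E) (Om : set (R * E)) (H : R * E -> R^o) (T : E -> R) :
  open W -> open Om -> smooth_in Om H ->
  (forall q, Om q -> 'D_((1, 0) : R * E) H q != 0) ->
  (forall z, W z -> Om (T z, z)) ->
  (forall z, W z -> H (T z, z) = 0) ->
  (forall z, W z -> {for z, continuous T}) ->
  smooth_in W (T : E -> R^o).
Proof.
move=> oW oO sH Ht TO HT cT.
have dT z v : W z -> is_derive z v (T : E -> R^o)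
   (- ('D_((0, v) : R * E) H (T z, z) / 'D_((1, 0) : R * E) H (T z, z))).
  move=> Wz; have Oz := TO z Wz.
  apply: (implicit_function_derive oW Wz) => //.
  - exact: cT.
  - have := open_nbhs_nbhs (conj oO Oz).
    by apply: filterS => y; exact: smooth_in_derivable.
  - by apply: smooth_in_continuous Oz; exact: smooth_in_derive.
  - exact: smooth_in_derivable sH Oz.
  - exact: Ht.
pose G := [set (fun z => g (T z, z)) | g in [set g : R * E -> R^o | smooth_in Om g]].
apply: (smooth_in_algebra oW (G := G)).
- move=> _ z [g sg <-] Wz.
  apply: (continuous_comp (f := fun z => (T z, z))).
    by apply: continuous_pair; [exact: cT|exact: cvg_id].
  exact: smooth_in_continuous sg (TO z Wz).
- move=> _ v [g sg <-].
  pose d (j : 'I_(cdim (prod_coords C))) (z : E) : R :=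
    if unlift ord0 j is Some i then ccoord C i v
    else - ('D_((0, v) : R * E) H (T z, z) / 'D_((1, 0) : R * E) H (T z, z)).
  exists (fun z => \sum_j d j z * 'D_(cvec (prod_coords C) j) g (T z, z)).
    apply: alg_sum => j; apply: alg_mul.
      rewrite /d; case: (unlift ord0 j) => [i|]; first exact: alg_cst.
      apply: alg_gen; exists (fun q => -1 * ('D_((0, v) : R * E) H q *
           ('D_((1, 0) : R * E) H q)^-1) : R^o).
        apply: (smooth_inM oO); first exact: smooth_in_cst.
        apply: (smooth_inM oO); first exact: smooth_in_derive.
        by apply: (smooth_inV oO _ Ht); exact: smooth_in_derive.
      by apply/funext => z; rewrite mulN1r.
    apply: alg_gen; exists ('D_(cvec (prod_coords C) j) g); last by [].
    exact: smooth_in_derive.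
  move=> z Wz; have Oz := TO z Wz.
  apply: (is_derive_comp (C := prod_coords C) (phi := fun z => (T z, z))
     (d := d ^~ z)) => j.
  - have := open_nbhs_nbhs (conj oO Oz).
    by apply: filterS => y; exact: smooth_in_derivable.
  - by apply: smooth_in_continuous Oz; exact: smooth_in_derive.
  rewrite /d /= /prod_ccoord; case: (unlift ord0 j) => [i|]; last exact: dT.
  by apply: is_derive_linear; exact: ccoord_linear.
- apply: alg_gen; exists fst; last by [].
  exact: smooth_in_fst.
Qed.

(** * Trajectories through a transversal slice *)

Section slice_box.
Variables (R : realType) (X : topologicalType) (Phi : R * X -> X).
Hypothesis cPhi : continuous Phi.
Hypothesis Phi0 : forall x, Phi (0, x) = x.
Hypothesis PhiD : forall t s x, Phi (t + s, x) = Phi (t, Phi (s, x)).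
Variables (h : X -> R) (N D : set X) (delta : R).
Hypotheses (oN : open N) (delta_gt0 : 0 < delta).
Hypothesis ND : forall y s, N y -> `|s| < 2 * delta -> D (Phi (s, y)).
Hypothesis ch : forall x, D x -> {for x, continuous h}.
Hypothesis h_lt : forall y s s', N y -> `|s| < 2 * delta ->
  `|s'| < 2 * delta -> s < s' -> h (Phi (s, y)) < h (Phi (s', y)).

(** The slice is the part of {h = 0} that lies in N; t is a time, positive or
    negative, at which the trajectory of x meets it. *)
Definition hits (x : X) (t : R) : Prop :=
  [/\ `|t| < delta, N (Phi (t, x)) & h (Phi (t, x)) = 0].

Definition slice_box : set X := [set x | exists t, hits x t].

Definition hit_time (x : X) : R := xget 0 [set t | hits x t].

Lemma small_double (s : R) : `|s| < delta -> `|s| < 2 * delta.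
Proof. by move=> sd; apply: lt_trans sd _; rewrite ltr_pMl// ltr1n. Qed.

Lemma double_gt0 : `|0 : R| < 2 * delta.
Proof. by rewrite normr0 mulr_gt0. Qed.

Lemma slice_sub y : N y -> D y.
Proof. by move=> Ny; rewrite -(Phi0 y); exact: ND double_gt0. Qed.

(** h is strictly monotone along a trajectory for times in ]-2 delta, 2 delta[.
    The factor 2 is there because differences of two hitting times are compared
    with 0. *)
Lemma slice_return0 y s : N y -> h y = 0 -> `|s| < 2 * delta ->
  h (Phi (s, y)) = 0 -> s = 0.
Proof.
move=> Ny hy sd hs; have := h_lt Ny; rewrite -{1}(Phi0 y) in hy.
case: (ltgtP s 0) => // s0 H.
  by have := H s 0 sd double_gt0 s0; rewrite hs hy ltxx.
by have := H 0 s double_gt0 sd s0; rewrite hs hy ltxx.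
Qed.

Lemma hits_unique x t t' : hits x t -> hits x t' -> t = t'.
Proof.
move=> [td Nt ht] [td' Nt' ht'].
apply/esym/eqP; rewrite -subr_eq0; apply/eqP.
apply: (slice_return0 Nt ht); last by rewrite -PhiD subrK.
by rewrite (le_lt_trans (ler_normB _ _))// mulrDl mul1r ltrD.
Qed.

Lemma hit_timeP x : slice_box x -> hits x (hit_time x).
Proof. by move=> xU; exact: (xgetPex 0 xU). Qed.

Lemma hit_timeE x t : hits x t -> hit_time x = t.
Proof.
by move=> xt; apply: (hits_unique _ xt); apply: hit_timeP; exists t.
Qed.

Lemma continuous_Phi_left t x : {for x, continuous (fun y => Phi (t, y))}.
Proof.
apply: (continuous_comp (f := fun y => (t, y))); last exact: cPhi.
by apply: continuous_pair; [exact: cst_continuous|exact: cvg_id].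
Qed.

Lemma continuous_Phi_right t x : {for t, continuous (fun s => Phi (s, x))}.
Proof.
apply: (continuous_comp (f := fun s => (s, x))); last exact: cPhi.
by apply: continuous_pair; [exact: cvg_id|exact: cst_continuous].
Qed.

(** For small e, the function h has opposite signs at times t - e and t + e
    along the trajectory of x, hence along that of x', and the intermediate
    value theorem gives a hitting time of x' in between.  This yields both the openness of
    the box and the continuity of the hitting time. *)
Lemma hits_near x t (eta : R) : hits x t -> 0 < eta ->
  \forall x' \near x, exists2 t', `|t' - t| < eta & hits x' t'.
Proof.
move=> [td Nt ht] eta0.
have : nbhs (t, x) (Phi @^-1` N) by apply: cPhi; exact: open_nbhs_nbhs.
move=> [[P Q] /= [/nbhs_ballP[r /= r0 rP] xQ] PQ].
(* e is less than r, to remain in N; than eta, for closeness to t; and than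
   delta - |t|, so that the new time is still less than delta. *)
pose e := Num.min (Num.min r eta) (delta - `|t|) / 2.
have m0 : 0 < Num.min (Num.min r eta) (delta - `|t|).
  by rewrite !lt_min r0 eta0 subr_gt0 td.
have e0 : 0 < e by rewrite divr_gt0.
have em : e < Num.min (Num.min r eta) (delta - `|t|).
  by rewrite ltr_pdivrMr// ltr_pMr// ltr1n.
have [er eeta ed] : [/\ e < r, e < eta & e < delta - `|t|].
  by move: em; rewrite !lt_min => /andP[/andP[]].
have e2 : `|e| < 2 * delta.
  apply: small_double; rewrite gtr0_norm//; apply: lt_le_trans ed _.
  by rewrite lerBlDr lerDl.
have D1 s : `|s| <= e -> D (Phi (t + s, x)).
  move=> se; rewrite addrC PhiD; apply: ND => //.
  by apply: le_lt_trans se _; rewrite -(gtr0_norm e0).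
have hp : 0 < h (Phi (t + e, x)).
  rewrite addrC PhiD -{1}ht -{1}(Phi0 (Phi (t, x))).
  by apply: h_lt => //; exact: double_gt0.
have hm : h (Phi (t - e, x)) < 0.
  rewrite addrC PhiD -[X in _ < X]ht -{2}(Phi0 (Phi (t, x))).
  by apply: h_lt => //; rewrite ?normrN ?oppr_lt0//; exact: double_gt0.
have chP s : `|s| <= e -> {for x, continuous (fun x' => h (Phi (t + s, x')))}.
  move=> se; apply: (continuous_comp (f := fun x' => Phi (t + s, x'))).
    exact: continuous_Phi_left.
  exact/ch/D1.
near=> x'.
have Nx' s : `|s - t| <= e -> N (Phi (s, x')).
  move=> se; apply: (PQ (s, x')); split=> /=.
    by apply: rP; rewrite -ball_normE /= distrC; exact: le_lt_trans er.
  by near: x'.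
have fp : 0 < h (Phi (t + e, x')).
  near: x'; apply: (cvgr_gt (h (Phi (t + e, x)))) => //.
  by apply: chP; rewrite gtr0_norm.
have fm : h (Phi (t - e, x')) < 0.
  near: x'; apply: (cvgr_lt (h (Phi (t - e, x)))) => //.
  by apply: (chP (- e)); rewrite normrN gtr0_norm.
have te : t - e <= t + e by rewrite lerD2l ge0_cp ?ltW.
have [||s /[!in_itv]/= /andP[s1 s2] hs] :=
    @IVT R (fun s => h (Phi (s, x'))) _ _ 0 te.
- apply: continuous_in_subspaceT => s /[!inE]/=; rewrite in_itv/= => /andP[s1 s2].
  apply: (continuous_comp (f := fun s => Phi (s, x'))).
    exact: continuous_Phi_right.
  by apply/ch/slice_sub/Nx'; rewrite ler_distl s1 s2.
- by rewrite ge_min le_max (ltW fm) (ltW fp) orbT.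
have st : `|s - t| <= e by rewrite ler_distl s1 s2.
exists s; first exact: le_lt_trans eeta.
split; [|exact: Nx'|by []].
rewrite -(subrK t s) (le_lt_trans (ler_normD _ _))// -ltrBrDr.
exact: le_lt_trans ed.
Unshelve. all: by end_near. Qed.

Lemma slice_box_open : open slice_box.
Proof.
rewrite openE => x [t xt]; rewrite /interior.
have := hits_near xt ltr01; apply: filterS => x' [t' _ xt'].
by exists t'.
Qed.

Lemma hit_time_continuous x : slice_box x -> {for x, continuous hit_time}.
Proof.
move=> xU; apply/cvgrPdist_lt => e e0.
have := hits_near (hit_timeP xU) e0; apply: filterS => x' [t' tt' xt'].
by rewrite (hit_timeE xt') distrC.
Qed.

Lemma slice_box_flow x s : slice_box x -> `|hit_time x - s| < delta ->
  hits (Phi (s, x)) (hit_time x - s).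
Proof.
move=> /hit_timeP[td Nt ht] xs.
by split=> //; rewrite -PhiD subrK.
Qed.

Lemma slice_box_sub : slice_box `<=` D.
Proof.
move=> x [t [td Nt _]]; rewrite -(Phi0 x) -(addNr t) PhiD; apply: ND => //.
by rewrite normrN; exact: small_double.
Qed.

(** If a trajectory stays in the box from time 0 to eta, then the defect
    d r = theta (Phi (r, x)) + r - theta x is continuous, vanishes at 0, and is
    either 0 or at least 2 delta in absolute value by uniqueness of the hitting
    time; hence it vanishes throughout. *)
Lemma flow_dom_slice_box : flow_dom Phi slice_box =
  [set p | slice_box p.2 /\ `|hit_time p.2 - p.1| < delta].
Proof.
apply/seteqP; split=> [[eta x] /= [xU Hx]|[eta x] /= [xU Hx]]; split=> //; last first.
  move=> s /andP[s1 s2]; exists (hit_time x - s); apply: slice_box_flow => //.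
  have [td _ _] := hit_timeP xU.
  move: Hx td s1 s2; rewrite !ltr_norml.
  by case: (leP 0 eta) => _ /andP[? ?] /andP[? ?] ? ?; apply/andP; split; lra.
have xt := hit_timeP xU.
(* The defect of theta (Phi (r, x)) = theta x - r. *)
pose d r := hit_time (Phi (r, x)) + r - hit_time x.
have dE r : slice_box (Phi (r, x)) -> `|d r| < 2 * delta -> d r = 0.
  move=> /hit_timeP[_ _ hr] dr; have [_ Nt ht] := xt.
  by apply: (slice_return0 Nt ht) => //; rewrite -PhiD subrK PhiD.
have d0 : d 0 = 0 by rewrite /d Phi0 addr0 subrr.
suff deta : d eta = 0.
  have Ueta : slice_box (Phi (eta, x)).
    by apply: Hx; rewrite ge_min le_max !lexx !orbT.
  have [+ _ _] := hit_timeP Ueta.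
  rewrite -(addrK eta (hit_time (Phi (eta, x)))).
  by rewrite -[_ + eta](subrK (hit_time x)) -/(d eta) deta add0r.
have cd r : Num.min 0 eta <= r <= Num.max 0 eta -> {for r, continuous d}.
  move=> /Hx Ur; apply: cvgB; last exact: cvg_cst.
  apply: cvgD; last exact: cvg_id.
  apply: (continuous_comp (f := fun r => Phi (r, x))).
    exact: continuous_Phi_right.
  exact: hit_time_continuous.
have Ueta : slice_box (Phi (eta, x)).
  by apply: Hx; rewrite ge_min le_max !lexx !orbT.
have [/(dE _ Ueta)//|dbig] := ltP `|d eta| (2 * delta).
have mM : Num.min 0 eta <= Num.max 0 eta by rewrite ge_min le_max lexx.
have [||r /[!in_itv]/= rI dr] := @IVT R (fun r => `|d r|) _ _ delta mM.
- apply: continuous_in_subspaceT => r /[!inE]/=; rewrite in_itv/= => /cd.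
  exact: (cvg_norm (f := d)).
- have dd : delta <= `|d eta|.
    by apply: le_trans dbig; rewrite ler_pMl// ler1n.
  have [e0|e0] := leP 0 eta.
    by rewrite d0 normr0 ge_min le_max dd (ltW delta_gt0) orbT.
  by rewrite d0 normr0 ge_min le_max dd (ltW delta_gt0) orbT.
have : d r = 0.
  by apply: dE; [exact: Hx|rewrite dr ltr_pMl// ltr1n].
by move=> d0r; move: dr; rewrite d0r normr0 => dr; move: delta_gt0; rewrite -dr ltxx.
Qed.

End slice_box.

(** * The flow box of a non-vanishing vector field *)

Section flow_box.
Variables (R : realType) (n : nat) (X : topologicalType).
Variables (A : set (chart 'rV[R]_n X)) (c : chart 'rV[R]_n X).
Hypotheses (chA : forall d, A d -> is_chart d) (Ac : A c).
Variable xi : chart 'rV[R]_n X -> X -> 'rV[R]_n.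
Hypothesis sxi : smooth_in (cmap c @` cdom c) (xi c \o cinv c).
Variables (Phi : R * X -> X) (fPhi : classical_flow A xi Phi).
Variables (x0 : X) (j : 'I_n).
Hypotheses (cx0 : cdom c x0) (xi0 : xi c x0 0 j != 0).

Let E : normedModType R := 'rV[R]_n.
Let C : coords E := rV_coords R n.
Let pc := prod_chart c.
Let cK x : cdom c x -> cinv c (cmap c x) = x.
Proof. by have [_ _ + _ _] := chA Ac; apply. Qed.
Let oc : open (cdom c). Proof. by have [] := chA Ac. Qed.
Let cPhi : continuous Phi. Proof. by have [[]] := fPhi. Qed.
Let Phi0 x : Phi (0, x) = x. Proof. by have [] := fPhi. Qed.
Let PhiD t s x : Phi (t + s, x) = Phi (t, Phi (s, x)).
Proof. by have [] := fPhi. Qed.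

Let sPhi : smooth_in (cmap pc @` (cdom pc `&` Phi @^-1` cdom c))
  (cmap c \o Phi \o cinv pc).
Proof.
have [[_ sP] _ _ _] := fPhi; apply: sP Ac.
by exists c.
Qed.

Let slope x := xi c x0 0 j * xi c x 0 j.
Let height x := xi c x0 0 j * (cmap c x 0 j - cmap c x0 0 j).
Let upward := [set x | cdom c x /\ 0 < slope x].

Let slope_continuous x : cdom c x -> {for x, continuous slope}.
Proof.
move=> cx; apply: cvgM; first exact: cvg_cst.
have [_ _ _ cc _] := chA Ac.
have : {for x, continuous ((xi c \o cinv c) \o cmap c)}.
  apply: continuous_comp; first exact: cc.
  by apply: smooth_in_continuous sxi _; exists x.
have nx := open_nbhs_nbhs (conj oc cx).
move=> /(continuous_near_eq (f := xi c)) H.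
have {H} : {for x, continuous (xi c)}.
  by apply: H; apply: filterS nx => y cy /=; rewrite cK.
move=> H; apply: (continuous_comp (g := fun v : 'rV[R]_n => v 0 j) H).
exact: rV_coord_continuous.
Qed.

Let height_continuous x : cdom c x -> {for x, continuous height}.
Proof.
move=> cx; apply: cvgM; first exact: cvg_cst.
apply: cvgB; last exact: cvg_cst.
have [_ _ _ cc _] := chA Ac.
apply: (continuous_comp (f := cmap c) (g := fun v : 'rV[R]_n => v 0 j)).
  exact: cc.
exact: rV_coord_continuous.
Qed.

Let upward_open : open upward.
Proof.
rewrite openE => x [cx sx]; rewrite /interior.
have nx := open_nbhs_nbhs (conj oc cx).
have cs : slope y @[y --> x] --> slope x by exact: slope_continuous.
have sx' : \forall y \near x, 0 < slope y by exact: (cvgr_gt _ cs).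
exact: filterS2 nx sx'.
Qed.

Let flow_is_derive (t : R) x : cdom c (Phi (t, x)) ->
  is_derive t 1 (fun s => cmap c (Phi (s, x))) (xi c (Phi (t, x))).
Proof.
move=> cy; have [_ ode _ _] := fPhi.
apply: DeriveDef; last by rewrite -(ode t x c Ac cy) derive1E.
have : derivable (cmap c \o Phi \o cinv pc) (0, cmap c (Phi (t, x))) (1, 0).
  apply: smooth_in_derivable sPhi _; exists (0, Phi (t, x)) => //.
  by split=> //=; rewrite Phi0.
have quotE : (fun s : R => s^-1 *: (((cmap c \o Phi \o cinv pc) \o
      shift (0, cmap c (Phi (t, x)))) (s *: (1, 0)) -
      (cmap c \o Phi \o cinv pc) (0, cmap c (Phi (t, x))))) =
    (fun s : R => s^-1 *: (((fun s => cmap c (Phi (s, x))) \o shift t) (s *: 1) -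
      cmap c (Phi (t, x)))).
  apply/funext => s; rewrite /= scaler0 !add0r addr0 cK// Phi0 -PhiD.
  by rewrite /GRing.scale /=.
by rewrite /derivable quotE.
Qed.

Let height_is_derive (t : R) x : cdom c (Phi (t, x)) ->
  is_derive t 1 ((fun s => height (Phi (s, x))) : R -> R^o) (slope (Phi (t, x))).
Proof.
move=> /flow_is_derive /(is_derive_ccoord (C := C) j) d1.
have := is_deriveM (is_derive_cst (xi c x0 0 j : R^o) t 1)
  (is_deriveB d1 (is_derive_cst (cmap c x0 0 j : R^o) t 1)).
by move=> H; apply: is_derive_eq H _; rewrite /= subr0 scaler0 addr0.
Qed.

Let height_lt (delta : R) y (s s' : R) :
  (forall r, `|r| < delta -> upward (Phi (r, y))) ->
  `|s| < delta -> `|s'| < delta -> s < s' ->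
  height (Phi (s, y)) < height (Phi (s', y)).
Proof.
move=> up; rewrite !ltr_norml => /andP[s1 s2] /andP[s1' s2'] ss'.
have up' r : s <= r <= s' -> upward (Phi (r, y)).
  move=> /andP[sr rs']; apply: up; rewrite ltr_norml.
  by rewrite (lt_le_trans s1 sr) (le_lt_trans rs' s2').
have [||r /[!in_itv]/= /andP[sr rs'] Hr] := @MVT_segment R
  (fun s => height (Phi (s, y))) (fun r => slope (Phi (r, y))) s s' (ltW ss').
- move=> r /[!in_itv]/= /andP[sr rs']; apply: height_is_derive.
  by have [] := up' r; rewrite ?ltW.
- apply: derivable_within_continuous => r /[!in_itv]/= /up'[cr _].
  by have [] := height_is_derive cr.
rewrite -subr_gt0 Hr mulr_gt0 ?subr_gt0//.
by have [] := up' r; rewrite ?sr ?rs'.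
Qed.

(* H is the height reached after flowing for time t from a point of coordinates z;
   the first-hitting time theta solves H (theta, z) = 0, and Om is a domain where
   H is defined in coordinates and increases with t. *)
Let dom := [set p : R * X | cdom c p.2 /\ upward (Phi p)].
Let Om := cmap pc @` dom.
Let H (q : R * E) : R^o := height (Phi (cinv pc q)).

Let dom_open : open dom.
Proof.
apply: (@openI _ [set p : R * X | cdom c p.2] (Phi @^-1` upward)).
  exact: open_preimage_snd.
by apply: open_comp upward_open => p _; exact: cPhi.
Qed.

Let Om_open : open Om.
Proof.
rewrite /Om (chart_imageE (c := pc)); last by move=> p [].
by apply: chart_image_open; [exact/prod_is_chart/chA|exact: dom_open].
Qed.

Let H_smooth : smooth_in Om H.
Proof.
have s1 : smooth_in Om (ccoord C j \o (cmap c \o Phi \o cinv pc) : R * E -> R^o).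
  apply: (smooth_in_ccoord (C := C) j Om_open).
  by apply: smooth_inS sPhi => _ [p [cp [cP _]] <-]; exists p.
apply: (smooth_inM Om_open); first exact: smooth_in_cst Om_open.
by apply: (smooth_inD Om_open s1); exact: smooth_in_cst Om_open.
Qed.

Let H_slope p : dom p -> 'D_((1, 0) : R * E) H (cmap pc p) = slope (Phi p).
Proof.
case: p => t x [/= cx [cP _]].
have [_ <-] := height_is_derive cP.
have quotE : (fun s : R => s^-1 *: ((H \o shift (t, cmap c x)) (s *: (1, 0)) -
      H (t, cmap c x))) =
    (fun s : R => s^-1 *: (((fun s => height (Phi (s, x)) : R^o) \o shift t) (s *: 1) -
      height (Phi (t, x)))).
  by apply/funext => s; rewrite /H /= scaler0 add0r cK.
by rewrite /derive quotE.
Qed.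

(** The slice box of the height function.  Along the flow, height has
    derivative slope, which is positive near x0 because it equals xi_j(x0)^2 at
    x0; this gives the monotonicity required of the box.  It also makes the
    time derivative of H nonzero, so that the hitting time is smooth by the
    implicit function theorem. *)
Lemma flow_box_exists : exists (U : set X) (theta : X -> R) (delta : R),
  [/\ open U, U x0, U `<=` cdom c & 0 < delta] /\
  [/\ forall x, U x -> {for x, continuous theta},
      smooth_in (cmap c @` U) (theta \o cinv c : E -> R^o),
      forall x s, U x -> `|theta x - s| < delta ->
        U (Phi (s, x)) /\ theta (Phi (s, x)) = theta x - s &
      flow_dom Phi U = [set p | U p.2 /\ `|theta p.2 - p.1| < delta]].
Proof.
have up0 : upward (Phi (0, x0)).
  by rewrite Phi0; split=> //; rewrite /slope -expr2 exprn_even_gt0.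
have : nbhs (0, x0) (Phi @^-1` upward) by apply: cPhi; exact: open_nbhs_nbhs.
move=> [[P Q] /= [/nbhs_ballP[r /= r0 rP] x0Q] PQ].
pose N := Q°; have oN : open N by exact: open_interior.
(* Half of r, since the slice box looks at times up to 2 * delta. *)
pose delta := r / 2; have d0 : 0 < delta by rewrite divr_gt0.
have d2 : 2 * delta = r by rewrite mulrC divfK.
have Nup y s : N y -> `|s| < 2 * delta -> upward (Phi (s, y)).
  move=> /nbhs_singleton Qy; rewrite d2 => sr; apply: (PQ (s, y)); split=> //=.
  by apply: rP; rewrite -ball_normE /= sub0r normrN.
have ND y s : N y -> `|s| < 2 * delta -> cdom c (Phi (s, y)).
  by move=> Ny sd; have [] := Nup y s Ny sd.
have hlt y s s' : N y -> `|s| < 2 * delta -> `|s'| < 2 * delta -> s < s' ->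
    height (Phi (s, y)) < height (Phi (s', y)).
  by move=> Ny; apply: height_lt => t; exact: Nup.
pose U := slice_box Phi height N delta.
pose theta := hit_time Phi height N delta.
have oU : open U := slice_box_open cPhi Phi0 PhiD oN d0 ND height_continuous hlt.
have Uc : U `<=` cdom c := slice_box_sub Phi0 PhiD d0 ND.
have ct x : U x -> {for x, continuous theta} :=
  hit_time_continuous cPhi Phi0 PhiD oN d0 ND height_continuous hlt (x := x).
exists U, theta, delta; split; split=> //.
- exists 0; split; rewrite ?normr0// Phi0.
    by rewrite /N /interior.
  by rewrite /height subrr mulr0.
- have oW : open (cmap c @` U).
    by rewrite (chart_imageE Uc); apply: chart_image_open; [exact: chA|].
  have thetaP z : (cmap c @` U) z ->
      [/\ U (cinv c z), cmap c (cinv c z) = z & dom (theta (cinv c z), cinv c z)].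
    move=> [x Ux <-]; rewrite cK; last exact: Uc.
    split=> //; split; first exact: Uc.
    have [_ Ny _] := hit_timeP Ux.
    by rewrite -(Phi0 (Phi _)); apply: Nup => //; rewrite normr0 mulr_gt0.
  apply: (implicit_function_smooth C oW Om_open H_smooth).
  + by move=> _ [p dp <-]; rewrite (H_slope dp); case: dp => _ [_ /lt0r_neq0].
  + move=> z /thetaP[Uz zK dz]; exists (theta (cinv c z), cinv c z) => //.
    by rewrite /= zK.
  + by move=> z /thetaP[Uz zK dz]; rewrite /H /=; have [_ _] := hit_timeP Uz.
  + move=> z Wz; have [_ _ _ _ ic] := chA Ac.
    apply: (continuous_comp (f := cinv c)).
      by apply: ic; case: Wz => x Ux <-; exists x => //; exact: Uc.
    by have [Uz _ _] := thetaP z Wz; exact: ct.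
- move=> x s Ux xs; have hx := slice_box_flow PhiD Ux xs.
  split; first by exists (theta x - s).
  exact: (hit_timeE Phi0 PhiD d0 hlt hx).
- exact: (flow_dom_slice_box cPhi Phi0 PhiD oN d0 ND height_continuous hlt).
Qed.

End flow_box.

(** * Invariant generalized functions on the flow box *)

Section box_nets.
Variables (R : realType) (n : nat) (X : topologicalType).
Variables (A : set (chart 'rV[R]_n X)) (c : chart 'rV[R]_n X).
Hypotheses (hA : smooth_atlas A) (Ac : A c).
Variables (Phi : R * X -> X) (sPhi : smooth_map (prod_atlas A) A Phi).
Hypothesis PhiD : forall t s x, Phi (t + s, x) = Phi (t, Phi (s, x)).
Variables (U : set X) (theta : X -> R) (delta : R).
Hypotheses (oU : open U) (Uc : U `<=` cdom c) (delta_gt0 : 0 < delta).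
Hypothesis ctheta : forall x, U x -> {for x, continuous theta}.
Hypothesis stheta :
  smooth_in (cmap c @` U) (theta \o cinv c : 'rV[R]_n -> R^o).
Hypothesis theta_flow : forall x s, U x -> `|theta x - s| < delta ->
  U (Phi (s, x)) /\ theta (Phi (s, x)) = theta x - s.
Hypothesis flow_domE :
  flow_dom Phi U = [set p | U p.2 /\ `|theta p.2 - p.1| < delta].

Let E : normedModType R := 'rV[R]_n.
Let C : coords E := rV_coords R n.
Let RC := prod_coords C.
Let RA := prod_atlas A.
Let pc := prod_chart c.
Let V := flow_dom Phi U.
Let cA : coord_atlas C A := smooth_atlas_coord C hA.
Let cRA : coord_atlas RC RA := prod_coord_atlas cA.
Let RAc : RA pc. Proof. by exists c. Qed.
Let Vpc : V `<=` cdom pc. Proof. by move=> p [/Uc]. Qed.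
Let cK x : cdom c x -> cinv c (cmap c x) = x.
Proof. by have [_ _ + _ _] := cA.1 c Ac; apply. Qed.

Let oV : open V.
Proof.
rewrite openE => p; rewrite /V flow_domE => -[Up tp]; rewrite /interior.
have nU : \forall q \near p, U q.2.
  by apply: open_nbhs_nbhs; split => //; exact: open_preimage_snd.
have ct : (theta q.2 - q.1) @[q --> p] --> theta p.2 - p.1.
  apply: cvgB; last exact: cvg_fst.
  apply: (continuous_comp (f := snd)); first exact: cvg_snd.
  exact: ctheta.
have nt : \forall q \near p, `|theta q.2 - q.1| < delta.
  exact: (cvgr_lt _ (cvg_norm ct)).
by apply: filterS2 nU nt => q Uq tq.
Qed.

Let oDU : open (cmap c @` U) := chart_domain_open cA Ac oU Uc.
Let oDV : open (cmap pc @` V) := chart_domain_open cRA RAc oV Vpc.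

Lemma net_of_flow b u :
  net_of b A U u -> net_of b RA V (fun e p => u e (Phi p)).
Proof.
have [cPhi smPhi] := sPhi.
apply: (net_of_pullback cRA cA RAc oV Vpc Ac oU Uc) => [[t x] [Ux UV]|p _|j].
- by apply: UV; rewrite ge_min le_max !lexx !orbT.
- exact: cPhi.
apply: (smooth_in_ccoord (C := C) j (f := cmap c \o Phi \o cinv pc) oDV).
apply: smooth_inS (smPhi pc c RAc Ac) => _ [[t x] [Ux UV] <-].
exists (t, x) => //; split; first exact: Uc.
by apply/Uc/UV; rewrite /= ge_min le_max !lexx !orbT.
Qed.

Let smooth_in_ccoord_cst j : smooth_in (cmap c @` U) (ccoord C j : E -> R^o).
Proof.
apply: (smooth_in_linear oDU); [exact: ccoord_continuous|exact: ccoord_linear].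
Qed.

Let smooth_in_cmapK j :
  smooth_in (cmap c @` U) (fun z => ccoord C j (cmap c (cinv c z)) : R^o).
Proof.
apply: (smooth_in_eq oDU) (smooth_in_ccoord_cst j) => z /[!inE] -[x Ux <-].
by rewrite cK//; exact: Uc.
Qed.

Lemma net_of_snd b u : net_of b A U u -> net_of b RA V (fun e p => u e p.2).
Proof.
apply: (net_of_pullback cRA cA RAc oV Vpc Ac oU Uc) => [p []//|p _|j].
  exact: cvg_snd.
apply: (smooth_in_comp_snd C oDV oDU _ (smooth_in_cmapK j)).
by move=> _ [[t x] [Ux _] <-]; exists x.
Qed.

(** x |-> (theta x, x) takes its values in the flow domain, since the
    trajectory from x to the slice does not leave U. *)
Lemma net_of_section b w :
  net_of b RA V w -> net_of b A U (fun e x => w e (theta x, x)).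
Proof.
apply: (net_of_pullback cA cRA Ac oU Uc RAc oV Vpc) => [x Ux|x Ux|].
- by rewrite /V flow_domE /=; rewrite subrr normr0.
- by apply: continuous_pair; [exact: ctheta|exact: cvg_id].
apply: (prod_coordsP (P := fun l => smooth_in _
  (fun z => l (cmap pc (theta (cinv c z), cinv c z)) : R^o))) => [|i].
  exact: stheta.
exact: smooth_in_cmapK.
Qed.

(** All points of a trajectory in U reach the slice at the same point. *)
Lemma invariant_first_hit (g : X -> R) :
  invariant_fun Phi U (fun x => g (Phi (theta x, x))).
Proof.
move=> [t x]; rewrite -/V /V flow_domE => -[/= Ux xt].
have [_ ->] := theta_flow Ux xt.
by rewrite -PhiD subrK.
Qed.

(** If some representative v satisfies v o F1 = v o F2 exactly, then for any
    other representative v' the net v' o F1 differs from v o F2 by the pullback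
    under F1 of the negligible net v' - v. *)
Lemma glift_sub (F1 F2 : R * X -> X) (u0 v : R -> X -> R) :
  (forall b u, net_of b A U u -> net_of b RA V (fun e p => u e (F1 p))) ->
  (forall e, 0 < e <= 1 -> forall p, V p -> v e (F1 p) = v e (F2 p)) ->
  gclass A U u0 v ->
  glift RA V (fun v e p => v e (F1 p)) (gclass A U u0) `<=`
  glift RA V (fun v e p => v e (F2 p)) (gclass A U u0).
Proof.
move=> F1n vF uv w [v' [mv' nv'] [mw nw]]; exists v => //.
split=> //; have [mv nv] := uv.
have d1 := F1n true _ (net_ofB cA Ac oU Uc (b := true) nv' nv).
have d2 := net_ofD cRA RAc oV Vpc (b := true) d1 nw.
apply: (net_of_eq cRA RAc oV Vpc (b := true) _ d2) => e e01 p Vp /=.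
by rewrite -(vF e e01 p Vp); lra.
Qed.

Lemma invariant_genP u : colombeau A U u ->
  invariant_gen A Phi U u <->
  exists2 v : R -> X -> R, u v &
    forall e : R, 0 < e <= 1 -> invariant_fun Phi U (v e).
Proof.
move=> [u0 mu0 <-]; split=> [inv|[v uv vinv]]; last first.
  apply/seteqP; split.
    apply: (glift_sub (@net_of_flow) _ uv) => e e01 p Vp; exact: vinv.
  apply: (glift_sub (F1 := snd) (F2 := Phi) (@net_of_snd) _ uv) => e e01 p Vp.
  by rewrite (vinv e e01 p).
have z0 b : net_of b A U (fun e x => u0 e x - u0 e x).
  apply: (net_of_eq cA Ac oU Uc _ (net_of0 cA Ac oU Uc b)) => e _ x _.
  by rewrite subrr.
(* u0 o Phi belongs to the class of u o Phi, hence to that of u o pi_2. *)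
pose w e p := u0 e (Phi p).
have mw : moderate RA V w := @net_of_flow false u0 mu0.
have : glift RA V (fun v e p => v e (Phi p)) (gclass A U u0) w.
  exists u0; first by split=> //; exact: (z0 true).
  split=> //.
  apply: (net_of_eq cRA RAc oV Vpc (b := true) _
    (net_of0 cRA RAc oV Vpc true)) => e _ p _.
  by rewrite subrr.
rewrite inv => -[v [mv nv] [_ nw]].
exists (fun e x => u0 e (Phi (theta x, x))); last first.
  by move=> e _; exact: (invariant_first_hit (u0 e)).
split; first exact: (@net_of_section false w mw).
have d := @net_of_section true _ nw.
have := net_ofD cA Ac oU Uc (b := true) nv d.
apply: (net_of_eq cA Ac oU Uc (b := true)) => e _ x _ /=.
by rewrite /w addrA subrK.
Qed.

End box_nets.

Unset Implicit Arguments.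

Theorem proposition3p5 (R : realType) (n : nat) (X : topologicalType)
    (A : set (chart 'rV[R]_n X)) (hA : smooth_atlas A)
    (hconn : connected [set: X]) (hpara : paracompact X)
    (hhaus : hausdorff_space X)
    (xi : chart 'rV[R]_n X -> X -> 'rV[R]_n) (hxi : vector_field A xi)
    (hcomplete : G_complete A xi)
    (Phi : R * X -> X) (hPhi : is_flow A xi Phi)
    (x0 : X) (hx0 : xi (chart_at A x0) x0 != 0) :
  exists U : set X, [/\ open U, U x0 &
    forall u, colombeau A U u ->
      (invariant_gen A Phi U u <->
       exists2 v : R -> X -> R, u v &
         forall e : R, 0 < e <= 1 -> invariant_fun Phi U (v e))].
Proof.
have [chA coverA _] := hA.
have [c0 Ac0 c0x0] := coverA x0.
have [Ac cx0] : A (chart_at A x0) /\ cdom (chart_at A x0) x0.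
  exact: (@xgetPex {classic (chart 'rV[R]_n X)} _
    [set c | A c /\ cdom c x0] (ex_intro _ c0 (conj Ac0 c0x0))).
have [j xij] : exists j, xi (chart_at A x0) x0 0 j != 0.
  by move: hx0 => /rV0Pn.
have [fPhi _] := hPhi; have [sPhi _ _ PhiD] := fPhi.
have sxi := hxi.1 _ Ac.
have [U [theta [delta [[oU Ux0 Uc d0] [ct st th dE]]]]] :=
  flow_box_exists chA Ac sxi fPhi cx0 xij.
exists U; split=> // u uU.
exact: (invariant_genP hA Ac sPhi PhiD oU Uc d0 ct st th dE uU).
Qed.
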